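(* Let $X=\{X_t\}_{t\ge 0}$ be a real-valued Lévy process with Lévy measure $\nu$ and Lévy density $s$. Suppose that $s$ is Lipschitz in an open set $D_0$ containing $D=[a,b]\subset\mathbb{R}\setminus\{0\}$ and that $s(x)$ is uniformly bounded on $\{x:|x|>\delta\}$ for any $\delta>0$. Then there exist $k>0$ and $t_0>0$ such that, for all $0<t<t_0$, $$\sup_{y\in D}\left|\frac1t\,\mathbb{P}[X_t\ge y]-\nu([y,\infty))\right|<k\,t .$$
   Context: A Lévy process has independent and stationary increments, right-continuous paths with left limits, and no fixed jump times. Its law is determined by a triplet: a real $\sigma^2\ge0$ (Gaussian variance), a real drift parameter, and a Lévy measure $\nu$ on $\mathbb{R}\setminus\{0\}$ with $\int (x^2\wedge 1)\,\nu(dx)<\infty$. A Lévy density of $X$ is a function $s:\mathbb{R}\setminus\{0\}\to[0,\infty)$ with $\nu(A)=\int_A s(x)\,dx$ for all Borel $A\subset\mathbb{R}\setminus\{0\}$.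
   Formalization: The displayed bound is proved for 0<a; for b<0 it fails (P[X_t≥y]→1 for y<0, so (1/t)P[X_t≥y]→∞), and the bound is proved there instead with P[X_t≤y] and ν((−∞,y]). *)

(* Defs.v *)
From mathcomp Require Import all_boot all_order all_algebra.
From mathcomp Require Import all_classical all_reals all_analysis.

Set Implicit Arguments.
Unset Strict Implicit.
Unset Printing Implicit Defensive.

Import Order.TTheory GRing.Theory Num.Theory.
Import numFieldNormedType.Exports.

Local Open Scope classical_set_scope.
Local Open Scope ring_scope.

(* Processes are families [X : R -> {RV P >-> R}] of which only the indices
   [0 <= t] are ever constrained or used. *)
Section levy_process.
Context (d : measure_display) (T : measurableType d) (R : realType).
Variables (P : probability T R) (X : R -> {RV P >-> R}).

(* Taking some of the [B i] equal to [setT] shows that the product rule also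
   holds for every subfamily of the increments. *)
Definition independent_increments : Prop :=
  forall (n : nat) (tau : nat -> R) (B : 'I_n -> set R),
    0 <= tau 0%N ->
    (forall i : nat, (i < n)%N -> tau i <= tau i.+1) ->
    (forall i, measurable (B i)) ->
    P [set w | forall i : 'I_n, B i (X (tau i.+1) w - X (tau i) w)] =
    (\prod_(i < n) P [set w | B i (X (tau i.+1) w - X (tau i) w)%R])%E.

Definition stationary_increments : Prop :=
  forall (t h : R) (B : set R), 0 <= t -> 0 <= h -> measurable B ->
    P [set w | B (X (t + h) w - X t w)] = P [set w | B (X h w - X 0 w)].

Definition cadlag_paths : Prop :=
  {ae P, forall w,
    (forall t : R, 0 <= t -> X u w @[u --> t^'+] --> X t w) /\
    (forall t : R, 0 < t -> cvg (X u w @[u --> t^'-]))}.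

Definition no_fixed_jump : Prop :=
  forall t : R, 0 < t -> {ae P, forall w, X u w @[u --> t^'-] --> X t w}.

Definition levy_process : Prop :=
  [/\ {ae P, forall w, X 0 w = 0},
      independent_increments,
      stationary_increments,
      cadlag_paths
    & no_fixed_jump].

End levy_process.

Section levy_triplet.
Context (R : realType).
Implicit Types nu : {measure set (measurableTypeR R) -> \bar R}.

(* A measure on R \ {0} is encoded as a measure on R that does not charge 0. *)
Definition levy_measure nu : Prop :=
  nu [set 0] = 0%E /\ (\int[nu]_x (Num.min (x ^+ 2) 1)%:E < +oo)%E.

(* Real and imaginary parts of the Levy-Khintchine exponent
     psi(u) = i drift u - sigma2 u^2 / 2
              + \int (e^{iux} - 1 - iux 1_{|x| <= 1}) nu(dx). *)
Definition levy_exponent_re (sigma2 : R) nu (u : R) : R :=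
  - (sigma2 * u ^+ 2 / 2) + \int[nu]_x (cos (u * x) - 1).

Definition levy_exponent_im (drift : R) nu (u : R) : R :=
  drift * u + \int[nu]_x (sin (u * x) - u * x * (`|x| <= 1)%R%:R).

(* [E e^{iuX_t} = e^{t psi(u)}] for all t and u, by real and imaginary parts. *)
Definition levy_triplet (d : measure_display) (T : measurableType d)
    (P : probability T R) (X : R -> {RV P >-> R}) (sigma2 drift : R) nu : Prop :=
  [/\ 0 <= sigma2, levy_measure nu &
    forall t u : R, 0 <= t ->
      let m := expR (t * levy_exponent_re sigma2 nu u) in
      let a := t * levy_exponent_im drift nu u in
      ('E_P[fun w => cos (u * X t w)])%E = (m * cos a)%:E /\
      ('E_P[fun w => sin (u * X t w)])%E = (m * sin a)%:E].

(* A density is a function on R \ {0}, so the value [s 0] is irrelevant. *)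
Definition levy_density nu (s : R -> R) : Prop :=
  [/\ forall x : R, x != 0 -> 0 <= s x,
      measurable_fun [set~ (0 : R)] s &
      forall A : set R, measurable A -> A `<=` [set~ 0] ->
        nu A = (\int[lebesgue_measure]_(x in A) (s x)%:E)%E].

End levy_triplet.

(* Main.v *)
(* Only the laws [mu_t] of [X_t] matter: they form a convolution semigroup with
   Levy-Khintchine exponent. Differentiating the characteristic functions at
   [t = 0] gives [mu_t / t -> nu] away from 0 and [O(t)] bounds for the big-jump
   mass and for the first two truncated moments of [mu_t].

   Fix [t], split the time [t] into [n] steps of length [h = t / n] and call a step big
   if it exceeds [eps < a / 2].
   - No big step: by an exponential Chebyshev bound with parameter of order
     [- ln t], reaching [y >= a] has probability [O(t ^ 2)].
   - Two big steps or more: probability [O((n * h) ^ 2) = O(t ^ 2)].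
   - Otherwise the main term is [n] times the probability that one big step takes
     the sum of the other [n - 1] above [y]. For [n] large it is
     [t * E nu([y - X_(t - h), +oo[)] up to [O(t ^ 2)], and since the density is
     Lipschitz near [y], [nu([y - x, +oo[) = nu([y, +oo[) + s(y) x + O(x ^ 2)],
     whose average differs from [nu([y, +oo[)] by [O(t)].

   The case [b < 0] is the same statement for [- X], whence the sign [sg]. *)

Require Import Defs.
From mathcomp Require Import all_boot all_order all_algebra.
From mathcomp Require Import all_classical all_reals all_analysis.
From mathcomp Require Import measurable_realfun ring lra.
Import Order.TTheory GRing.Theory Num.Theory.
Import numFieldNormedType.Exports.
Local Open Scope classical_set_scope.
Local Open Scope ring_scope.
Set Implicit Arguments.
Unset Strict Implicit.
Unset Printing Implicit Defensive.

(** * Elementary estimates and Bernstein approximation *)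

(** The limit of [mu_t / t] comes without a rate, so at time [t] itself it would only give an error
    [o(1)]. Splitting cures this: with [t] fixed and [h] tending to 0, the relative error of [mu_h]
    drops below [t], and the [n] steps together cost [O(t ^ 2)]. Hence [n] depends on [t], and all
    other constants must be chosen before [t] and be free of [n]. For the limit, the factor
    [sin (u x) ^ 2] tames the singularity of [nu] at 0, and its products with polynomials in
    [sin (u x)] are still trigonometric polynomials, whose integrals under [mu_t] are explicit. As
    [sin (u x)] is injective only on a bounded window, the mass outside needs its own bound, by an
    arbitrarily small multiple of [t]; a truncation inequality for characteristic functions supplies
    it. The exponential parameter is [- 2 ln t / a]: Chebyshev then gains [t ^ 2], while the
    exponential moment of the small steps over the whole time [t] stays bounded as soon as
    [eps <= a / 4]. *)

Section elementary.
Context {R : realType}.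
Implicit Types x u : R.

Lemma ler_norm_sin x : `|sin x| <= `|x|.
Proof.
wlog x0 : x / 0 <= x.
  move=> H; have [/H//|/ltW x0] := leP 0 x.
  by rewrite -normrN -sinN -(normrN x) H// oppr_ge0.
move: x0; rewrite le_eqVlt => /predU1P[<-|x0]; first by rewrite sin0.
have [c _] := @MVT R sin cos 0 x x0 (fun x _ => is_derive_sin x)
  (continuous_subspaceT (@continuous_sin R)).
by rewrite sin0 !subr0 => ->; rewrite normrM ler_piMl// cos_max.
Qed.

Lemma ler_1Bcos x : 1 - cos x <= x ^+ 2 / 2.
Proof.
have -> : 1 - cos x = 2 * sin (x / 2) ^+ 2.
  by rewrite [in cos x](splitr x) cosD sin2cos2; have := cos2Dsin2 (x/2); nra.
suff : sin (x / 2) ^+ 2 <= (x / 2) ^+ 2 by nra.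
by rewrite -(real_normK (num_real (sin _))) -(real_normK (num_real (_ / _))) lerXn2r ?nnegrE// ler_norm_sin.
Qed.

Lemma ler_norm_sinB x : `|sin x - x| <= `|x| ^+ 3 / 2.
Proof.
wlog x0 : x / 0 <= x.
  move=> H; have [/H//|/ltW x0] := leP 0 x.
  by rewrite -normrN opprD -sinN -(normrN x) H// oppr_ge0.
move: x0; rewrite le_eqVlt => /predU1P[<-|x0].
  by rewrite sin0 subr0 normr0 expr0n mul0r.
have dF y : y \in `]0, x[ -> is_derive y 1 (fun y => sin y - y) (cos y - 1).
  by move=> _; apply: is_deriveB.
have [|c /[!in_itv]/= /andP[c0 cx]] := @MVT R _ _ 0 x x0 dF.
  by apply: continuous_subspaceT => y; apply: cvgB => //; exact: continuous_sin.
rewrite sin0 !subr0 => ->; rewrite normrM (gtr0_norm x0) exprSr mulrAC.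
rewrite ler_wpM2r ?(ltW x0)// -normrN opprB ger0_norm ?subr_ge0 ?cos_le1//.
rewrite (le_trans (ler_1Bcos c))// ler_wpM2r ?invr_ge0//.
by rewrite lerXn2r ?nnegrE// ltW.
Qed.

Lemma sin_ge_half x : 0 <= x <= 1 -> x / 2 <= sin x.
Proof.
move=> /andP[x0 x1]; have := ler_norm_sinB x; rewrite (ger0_norm x0).
move=> /ler_normlP[+ _]; rewrite opprB => h.
have : x ^+ 3 <= x by rewrite exprS ler_piMr// expr_le1.
lra.
Qed.

Lemma expR_le_quadratic x : expR x <= 1 + x + x ^+ 2 * expR `|x|.
Proof.
have H (y : R) : expR y - 1 <= y * expR y.
  have := expR_ge1Dx (- y); rewrite expRN; have := expR_gt0 y => e0.
  by rewrite -(ler_pM2r e0) mulVf ?gt_eqF//; lra.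
have [x0|x0] := leP 0 x.
  rewrite (ger0_norm x0); have := expR_ge1Dx x; have := H x => h1 h2.
  have : x * (expR x - 1) <= x * (x * expR x) by rewrite ler_wpM2l.
  lra.
have [] : expR x <= 1 /\ 1 <= expR `|x|.
  by rewrite expR_le1 (ltW x0) -[leLHS]expR0 ler_expR.
move=> ? e1; have h := expR_ge1Dx x; have := H x.
have : x ^+ 2 <= x ^+ 2 * expR `|x| by rewrite ler_peMr ?sqr_ge0.
nra.
Qed.

End elementary.

Section bernstein.
Context {R : realType}.

(** The Bernstein polynomial, as the mean of [g] at a binomial variable, conditioned on the first of
    the [n] trials. The recursion replaces binomial coefficients by inductions on [n]. *)
Fixpoint bern (n : nat) (g : nat -> R) : {poly R} :=
  if n is m.+1 then 'X * bern m (g \o S) + (1 - 'X) * bern m g else (g 0%N)%:P.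

Lemma bernS n g x : (bern n.+1 g).[x] =
  x * (bern n (g \o S)).[x] + (1 - x) * (bern n g).[x].
Proof. by rewrite /= !hornerE. Qed.

Lemma bern_le n g1 g2 x : 0 <= x <= 1 ->
  (forall i, (i <= n)%N -> g1 i <= g2 i) -> (bern n g1).[x] <= (bern n g2).[x].
Proof.
move=> /andP[x0 x1]; elim: n g1 g2 => [|n IH] g1 g2 h.
  by rewrite /= !hornerC h.
rewrite !bernS lerD// ler_wpM2l ?subr_ge0//; apply: IH => i ni /=; apply: h => //.
exact: leqW.
Qed.

Lemma bern_affine n (c0 c1 : R) g1 g2 x :
  (bern n (fun k => c0 * g1 k + c1 * g2 k)).[x] =
  c0 * (bern n g1).[x] + c1 * (bern n g2).[x].
Proof.
elim: n g1 g2 => [|n IH] g1 g2; first by rewrite /= !hornerC.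
by rewrite !bernS (IH (g1 \o S) (g2 \o S)) IH; ring.
Qed.

Lemma bern_cst n c x : (bern n (fun=> c)).[x] = c.
Proof.
elim: n => [|n IH]; first by rewrite /= hornerC.
by rewrite bernS IH; ring.
Qed.

(** Variance plus squared mean of a binomial variable shifted by [c]. The shift is left free because
    a success in the first trial turns [c] into [1 + c]. *)
Lemma bern_sqr n c x : (bern n (fun k => (k%:R + c) ^+ 2)).[x] =
  n%:R * x * (1 - x) + (n%:R * x + c) ^+ 2.
Proof.
elim: n c => [|n IH] c; first by rewrite /= hornerC; ring.
rewrite bernS (_ : _ \o _ = fun k => (k%:R + (1 + c)) ^+ 2); last first.
  by apply/funext => k /=; rewrite -natr1 -addrA.
by rewrite !IH -natr1; ring.
Qed.

End bernstein.

Lemma lipschitz_poly_approx {R : realType} (g : R -> R) (L eta : R) : 0 <= L -> 0 < eta ->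
  (forall x y, `|g x - g y| <= L * `|x - y|) ->
  exists p : {poly R}, forall v, -1 <= v <= 1 -> `|p.[v] - g v| <= eta.
Proof.
move=> L0 eta0 gL.
(* With this [n] the variance term below is at most [eta / 2], since [x * (1 - x) <= 1 / 4]. *)
have [n n0 nL] : exists2 n : nat, 0 < n%:R :> R & L ^+ 2 / eta ^+ 2 <= n%:R.
  by exists (Num.truncn (L ^+ 2 / eta ^+ 2)).+1; rewrite ?ltr0n// ltW// truncnS_gt.
pose gk (k : nat) := g (2 * (k%:R / n%:R) - 1).
exists ((bern n gk) \Po (2^-1 *: 'X + (2^-1)%:P)) => v v1.
set x := (v + 1) / 2.
have xE : 2^-1 * v + 2^-1 = x by rewrite /x; lra.
have x01 : 0 <= x <= 1 by rewrite /x; lra.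
rewrite horner_comp !hornerE xE.
(* Chebyshev's argument made pointwise: [2 * z <= eta / 2 + 2 * z ^ 2 / eta] with [z = L * |d|]. A
   quadratic majorant, whose Bernstein mean is known, replaces the absolute value. *)
have H k : `|gk k - g v| <= eta / 2 + 2 * L ^+ 2 / eta * (n%:R ^-2 * (k%:R + - (n%:R * x)) ^+ 2).
  rewrite (le_trans (gL _ _))//.
  set d := n%:R^-1 * (k%:R - n%:R * x).
  have -> : 2 * (k%:R / n%:R) - 1 - v = 2 * d.
    rewrite /d /x; field; exact: lt0r_neq0.
  have -> : n%:R^-2 * (k%:R - n%:R * x) ^+ 2 = d ^+ 2 by rewrite /d exprMn exprVn.
  rewrite normrM (ger0_norm (ler0n _ 2)) -(real_normK (num_real d)).
  move: (normr_ge0 d); set e := `|d| => e0.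
  have -> : 2 * L ^+ 2 / eta * e ^+ 2 = 2 * (L * e) ^+ 2 / eta by field; exact: lt0r_neq0.
  rewrite -subr_ge0 (_ : _ - _ = (2 * (L * e) - eta) ^+ 2 / (2 * eta)); last first.
    by field; exact: lt0r_neq0.
  by rewrite divr_ge0 ?sqr_ge0// mulr_ge0// ltW.
have V : (bern n (fun k => eta / 2 + 2 * L ^+ 2 / eta * (n%:R ^-2 * (k%:R + - (n%:R * x)) ^+ 2))).[x] <= eta.
  rewrite (_ : (fun _ => _) = fun k => 1 * (fun=> eta / 2) k + (2 * L ^+ 2 / eta * n%:R ^-2) * (fun k => (k%:R + - (n%:R * x)) ^+ 2) k); last first.
    by apply/funext => k; rewrite mul1r !mulrA.
  rewrite bern_affine bern_cst bern_sqr subrr expr0n addr0 mul1r.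
  have x4 : x * (1 - x) <= 4^-1 by have := sqr_ge0 (x - 2^-1); lra.
  rewrite [leLHS](_ : _ = eta / 2 + 2 * (L ^+ 2 / eta ^+ 2) * (x * (1 - x)) * (eta / n%:R)); last first.
    by field; rewrite !gt_eqF.
  have : 2 * (L ^+ 2 / eta ^+ 2) * (x * (1 - x)) <= 2 * n%:R * 4^-1.
    have q0 : 0 <= L ^+ 2 / eta ^+ 2 by rewrite divr_ge0 ?sqr_ge0.
    have xx0 : 0 <= x * (1 - x) by rewrite mulr_ge0 ?subr_ge0//; case/andP: x01.
    by apply: ler_pM => //; [exact: mulr_ge0|rewrite ler_wpM2l].
  move=> /(ler_wpM2r (ltW (divr_gt0 eta0 n0))).
  rewrite (_ : 2 * n%:R / 4 * _ = eta / 2); last by field; rewrite gt_eqF.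
  lra.
have cst b : (bern n (fun k => 1 * gk k + b * (fun=> 1) k)).[x] = (bern n gk).[x] + b.
  by rewrite bern_affine bern_cst mul1r mulr1.
rewrite ler_norml; apply/andP; split.
- rewrite -lerN2 opprK (le_trans _ V)//.
  rewrite (_ : - (_ - _) = (bern n (fun k => (-1) * gk k + g v * (fun=> 1) k)).[x]); last first.
    by rewrite bern_affine bern_cst; ring.
  by apply: bern_le => // i _; have := H i; rewrite distrC => /ler_normlW; lra.
- rewrite (le_trans _ V)// -cst.
  by apply: bern_le => // i _; have := H i; move=> /ler_normlW; lra.
Qed.

(** * Integrability against Levy measures *)

Section integration.
Context {R : realType}.
Implicit Types (m : probability R R) (f g : R -> R) (A : set R).

Lemma bounded_integrable d (T : measurableType d) (m : probability T R) (f : T -> R) (M : R) :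
  measurable_fun setT f -> (forall x, `|f x| <= M) -> m.-integrable setT (EFin \o f).
Proof.
move=> mf fM; apply: measurable_bounded_integrable => //.
  by rewrite (le_lt_trans (probability_le1 m measurableT))// ltry.
exists M; split; first exact: num_real.
by move=> y My x _ /=; apply: (le_trans (fM x)); exact: ltW.
Qed.

Lemma integrable_dominated (nu : {measure set R -> \bar R}) f g C :
  measurable_fun setT f -> (forall x, `|f x| <= C * g x) ->
  nu.-integrable setT (EFin \o g) -> nu.-integrable setT (EFin \o f).
Proof.
move=> mf fg ig; apply: (@le_integrable _ _ _ _ _ measurableT _ (fun x => C%:E * (EFin \o g) x)%E).
- exact/measurable_EFinP.
- by move=> x _; rewrite -EFinM !abse_EFin lee_fin (le_trans (fg x))// ler_norm.
- exact: integrableZl.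
Qed.

Lemma integrable_addR (nu : {measure set R -> \bar R}) f g :
  nu.-integrable setT (EFin \o f) -> nu.-integrable setT (EFin \o g) ->
  nu.-integrable setT (EFin \o (fun x => f x + g x)).
Proof. exact: integrableD. Qed.

Lemma integrable_subR (nu : {measure set R -> \bar R}) f g :
  nu.-integrable setT (EFin \o f) -> nu.-integrable setT (EFin \o g) ->
  nu.-integrable setT (EFin \o (fun x => f x - g x)).
Proof. exact: integrableB. Qed.

Lemma integrable_scaleR (nu : {measure set R -> \bar R}) c f :
  nu.-integrable setT (EFin \o f) -> nu.-integrable setT (EFin \o (fun x => c * f x)).
Proof. exact: integrableZl. Qed.

Lemma integrable_indicR m A : measurable A -> m.-integrable setT (EFin \o \1_A).
Proof. exact: integrable_indic. Qed.

Lemma Rintegral_indic m A : measurable A -> \int[m]_x (\1_A x) = fine (m A).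
Proof. by move=> mA; rewrite /Rintegral integral_indic// setIT. Qed.

Lemma Rintegral_cst_probability m c : \int[m]_x c = c.
Proof.
by rewrite Rintegral_cst// [X in fine X](probability_setT m) mulr1.
Qed.

End integration.

Section weight.
Context {R : realType}.
Definition levy_weight (x : R) : R := Num.min (x ^+ 2) 1.

Lemma levy_weight_ge0 x : 0 <= levy_weight x. Proof. by rewrite le_min sqr_ge0 ler01. Qed.

Lemma levy_weight_small x : `|x| <= 1 -> levy_weight x = x ^+ 2.
Proof. by move=> x1; apply/min_idPl; rewrite -(real_normK (num_real x)) expr_le1. Qed.

Lemma levy_weight_large x : 1 <= `|x| -> levy_weight x = 1.
Proof. by move=> x1; apply/min_idPr; rewrite -(real_normK (num_real x)) expr_ge1. Qed.

Lemma measurable_levy_weight : measurable_fun setT levy_weight.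
Proof. by apply: measurable_minr => //; exact: measurable_funX. Qed.

Lemma integrable_levy_weight (nu : {measure set R -> \bar R}) :
  (\int[nu]_x (levy_weight x)%:E < +oo)%E -> nu.-integrable setT (EFin \o levy_weight).
Proof.
move=> nuL; apply/integrableP; split; first by apply/measurable_EFinP; exact: measurable_levy_weight.
by under eq_integral do rewrite /= ger0_norm ?levy_weight_ge0//.
Qed.

Definition small_part (x : R) : R := x * (`|x| <= 1)%R%:R.

Lemma measurable_small_part : measurable_fun setT small_part.
Proof.
apply: measurable_funM => //.
rewrite (_ : (fun x : R => (`|x| <= 1)%R%:R) = \1_(`[(-1), 1]%classic)).
  exact: measurable_indic.
by apply/funext => x; rewrite indicE mem_setE in_itv/= ler_norml.
Qed.

Lemma norm_cosB1_le u x : `|cos (u * x) - 1| <= (u ^+ 2 + 2) * levy_weight x.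
Proof.
rewrite distrC ger0_norm ?subr_ge0 ?cos_le1//.
have u0 := sqr_ge0 u; have [x1|/ltW x1] := leP `|x| 1.
  rewrite (levy_weight_small x1); have := ler_1Bcos (u * x); rewrite exprMn => h.
  have := sqr_ge0 x; nra.
rewrite levy_weight_large// mulr1; have := cos_geN1 (u * x); lra.
Qed.

Lemma norm_sinB_small_part_le u x : `|sin (u * x) - u * small_part x| <= (`|u| ^+ 3 + 1) * levy_weight x.
Proof.
have u0 : 0 <= `|u| ^+ 3 by rewrite exprn_ge0.
rewrite /small_part; have [x1|/ltW x1] := leP `|x| 1.
  rewrite mulr1 (levy_weight_small x1) (le_trans (ler_norm_sinB _))// normrM exprMn.
  rewrite exprS -(real_normK (num_real x)).
  have : `|x| * `|x| ^+ 2 <= `|x| ^+ 2 by rewrite ler_piMl// exprn_ge0.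
  have := exprn_ge0 2 (normr_ge0 x); nra.
rewrite mulr0 mulr0 subr0 levy_weight_large// mulr1 (le_trans (sin_max _))//; lra.
Qed.

End weight.

(* [trigpoly F c0 c1 c2]: [F] is a trigonometric polynomial whose second order
   Taylor expansion at 0 is [c0 + c1 x + c2 x ^ 2 / 2]. *)
Inductive trigpoly {R : realType} : (R -> R) -> R -> R -> R -> Prop :=
| trigpoly_cos u : trigpoly (fun x => cos (u * x)) 1 0 (- u ^+ 2)
| trigpoly_sin u : trigpoly (fun x => sin (u * x)) 0 u 0
| trigpoly_lin c F G f0 f1 f2 g0 g1 g2 :
    trigpoly F f0 f1 f2 -> trigpoly G g0 g1 g2 ->
    trigpoly (fun x => c * F x + G x) (c * f0 + g0) (c * f1 + g1) (c * f2 + g2).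

Section trigpoly.
Context {R : realType}.
Implicit Types (F : R -> R) (u : R).

Lemma eq_trigpoly F G c0 c1 c2 d0 d1 d2 : F =1 G -> c0 = d0 -> c1 = d1 -> c2 = d2 ->
  trigpoly F c0 c1 c2 -> trigpoly G d0 d1 d2.
Proof. by move=> /funext -> -> -> ->. Qed.

(** The product-to-sum formulas keep the class closed. The coefficients are those of
    [c0 + c1 x + c2 x ^ 2 / 2] times [u x], as [sin (u x)] has no quadratic term. *)
Lemma trigpolyMsin F c0 c1 c2 u : trigpoly F c0 c1 c2 ->
  trigpoly (fun x => F x * sin (u * x)) 0 (c0 * u) (2 * c1 * u).
Proof.
elim=> [v|v|c G H g0 g1 g2 h0 h1 h2 _ IH1 _ IH2].
(* [T0] is the zero function; it ends the linear combination, since [trigpoly_lin] always asks for a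
   second summand. *)
- have T0 := trigpoly_lin 0 (trigpoly_sin (0 : R)) (trigpoly_sin (0 : R)).
  have T1 := trigpoly_lin 2^-1 (trigpoly_sin (u - v)) T0.
  have := trigpoly_lin 2^-1 (trigpoly_sin (u + v)) T1.
  apply: eq_trigpoly; [|ring|by field|ring].
  by move=> x; rewrite !mul0r sin0 mulrDl mulrBl sinD sinB; field.
- have T0 := trigpoly_lin 0 (trigpoly_sin (0 : R)) (trigpoly_sin (0 : R)).
  have T1 := trigpoly_lin 2^-1 (trigpoly_cos (u - v)) T0.
  have := trigpoly_lin (- 2^-1) (trigpoly_cos (u + v)) T1.
  apply: eq_trigpoly; [|by field|ring|by field].
  by move=> x; rewrite !mul0r sin0 mulrDl mulrBl cosD cosB; field.
- have := trigpoly_lin c IH1 IH2.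
  by apply: eq_trigpoly; [|ring..]; move=> x; ring.
Qed.

Lemma trigpoly_sinX u k : trigpoly (fun x => sin (u * x) ^+ k.+2) 0 0
  (if k is 0%N then 2 * u ^+ 2 else 0).
Proof.
elim: k => [|k IH].
  by have := trigpolyMsin u (trigpoly_sin u); apply: eq_trigpoly; [move=> x; ring|ring..].
have := trigpolyMsin u IH; apply: eq_trigpoly; [|ring..].
by move=> x; rewrite [RHS]exprSr.
Qed.

End trigpoly.

(** The factor [sin (u x) ^ 2] kills value and slope at 0, so these functions need no compensation
    against [nu], and only [p.[0]] enters the Gaussian term. *)
Lemma trigpoly_polysin {R : realType} (p : {poly R}) (u : R) :
  trigpoly (fun x => sin (u * x) ^+ 2 * p.[sin (u * x)]) 0 0 (2 * u ^+ 2 * p.[0]).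
Proof.
(* The exponent is generalized because peeling a coefficient off [q] passes one factor [sin (u x)]
   from the polynomial to the power. *)
suff H n (q : {poly R}) : trigpoly (fun x => sin (u * x) ^+ n.+2 * q.[sin (u * x)]) 0 0
    (if n is 0%N then 2 * u ^+ 2 * q.[0] else 0) by exact: H 0%N p.
elim/poly_ind: q n => [|q c IH] n.
  have := trigpoly_lin 0 (trigpoly_sin (0 : R)) (trigpoly_sin (0 : R)).
  apply: eq_trigpoly; [|ring|ring|].
    by move=> x; rewrite horner0 !mul0r sin0; ring.
  by case: n => *; rewrite ?horner0; ring.
have := trigpoly_lin c (trigpoly_sinX u n) (IH n.+1).
apply: eq_trigpoly; [|ring|ring|].
  by move=> x; rewrite hornerMXaddC [_ ^+ n.+3]exprSr; ring.
by case: n => *; rewrite ?hornerMXaddC; ring.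
Qed.

Lemma is_derive_cvg_at_right {R : realType} (f : R -> R) (l : R) :
  is_derive (0 : R) 1 f l -> (f t - f 0) / t @[t --> 0^'+] --> l.
Proof.
move=> [/[dup] df /cvg_ex[/= l' fl'] <-].
rewrite /derive (cvg_lim _ fl')//.
apply: cvg_dnbhs_at_right.
rewrite (_ : (fun t => _) = fun h => h^-1 *: (f (h *: 1 + 0) - f 0)); first exact: fl'.
by apply/funext => h; rewrite /= addr0 [h *: 1]mulr1 mulrC.
Qed.

Section trigpoly_integral.
Context {R : realType}.
Implicit Types (F : R -> R).

Lemma measurable_sinZ (u : R) : measurable_fun setT (fun x : R => sin (u * x)).
Proof.
apply: continuous_measurable_fun => x.
by apply: continuous_comp; [exact: mulrl_continuous|exact: continuous_sin].
Qed.

Lemma measurable_cosZ (u : R) : measurable_fun setT (fun x : R => cos (u * x)).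
Proof.
apply: continuous_measurable_fun => x.
by apply: continuous_comp; [exact: mulrl_continuous|exact: continuous_cos].
Qed.

Lemma measurable_trigpoly F c0 c1 c2 : trigpoly F c0 c1 c2 -> measurable_fun setT F.
Proof.
elim=> [u|u|c G H *]; [exact: measurable_cosZ|exact: measurable_sinZ|].
by apply: measurable_funD => //; exact: measurable_funM.
Qed.

Lemma bounded_trigpoly F c0 c1 c2 : trigpoly F c0 c1 c2 -> exists M, forall x, `|F x| <= M.
Proof.
elim=> [u|u|c G H ? ? ? ? ? ? _ [M GM] _ [N HN]].
- by exists 1 => x; exact: cos_max.
- by exists 1 => x; exact: sin_max.
- exists (`|c| * M + N) => x.
  by rewrite (le_trans (ler_normD _ _))// normrM lerD// ler_wpM2l.
Qed.

(** This is what makes the integral in [generator0] converge. *)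
Lemma trigpoly_taylor F c0 c1 c2 : trigpoly F c0 c1 c2 ->
  exists C, forall x, `|F x - c0 - c1 * small_part x| <= C * levy_weight x.
Proof.
elim=> [u|u|c G H g0 g1 g2 h0 h1 h2 _ [M GM] _ [N HN]].
- by exists (u ^+ 2 + 2) => x; rewrite mul0r subr0 norm_cosB1_le.
- by exists (`|u| ^+ 3 + 1) => x; rewrite subr0 norm_sinB_small_part_le.
- exists (`|c| * M + N) => x.
  rewrite (_ : _ - _ = c * (G x - g0 - g1 * small_part x) + (H x - h0 - h1 * small_part x)); last ring.
  rewrite (le_trans (ler_normD _ _))// normrM mulrDl lerD// -mulrA ler_wpM2l//.
Qed.

End trigpoly_integral.

Section exponent.
Context {R : realType}.
Variables (sigma2 drift : R) (nu : {measure set R -> \bar R}).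

Definition exponent_re (u : R) : R :=
  - (sigma2 * u ^+ 2 / 2) + \int[nu]_x (cos (u * x) - 1).

Definition exponent_im (u : R) : R :=
  drift * u + \int[nu]_x (sin (u * x) - u * small_part x).

(* The value at 0 of the generator on a function with expansion
   [c0 + c1 x + c2 x ^ 2 / 2] at 0. *)
Definition generator0 (F : R -> R) (c0 c1 c2 : R) : R :=
  c1 * drift + c2 * sigma2 / 2 + \int[nu]_x (F x - c0 - c1 * small_part x).

Definition has_exponent (mu : R -> probability R R) : Prop :=
  forall t u : R, 0 <= t ->
    \int[mu t]_x cos (u * x) = expR (t * exponent_re u) * cos (t * exponent_im u) /\
    \int[mu t]_x sin (u * x) = expR (t * exponent_re u) * sin (t * exponent_im u).

Hypothesis nuw : (\int[nu]_x (levy_weight x)%:E < +oo)%E.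
Variable mu : R -> probability R R.
Hypothesis muE : has_exponent mu.

Lemma integrable_trigpoly_nu F c0 c1 c2 : trigpoly F c0 c1 c2 ->
  nu.-integrable setT (EFin \o (fun x => F x - c0 - c1 * small_part x)).
Proof.
move=> FT; have [C FC] := trigpoly_taylor FT.
apply: (integrable_dominated _ FC); last exact: integrable_levy_weight.
apply: measurable_funB; first by apply: measurable_funB => //; exact: measurable_trigpoly FT.
by apply: measurable_funM => //; exact: measurable_small_part.
Qed.

Lemma integrable_trigpoly (m : probability R R) F c0 c1 c2 : trigpoly F c0 c1 c2 ->
  m.-integrable setT (EFin \o F).
Proof.
move=> FT; have [M FM] := bounded_trigpoly FT.
exact: bounded_integrable (measurable_trigpoly FT) FM.
Qed.

(** For cosine and sine this is the derivative at [t = 0] of the real and imaginary parts of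
    [exp (t psi(u))]; both sides are linear in [F]. *)
Lemma trigpoly_generator F c0 c1 c2 : trigpoly F c0 c1 c2 ->
  (\int[mu t]_x F x - c0) / t @[t --> 0^'+] --> generator0 F c0 c1 c2.
Proof.
elim=> [u|u|c G H g0 g1 g2 h0 h1 h2 TG IG TH IH].
- rewrite (_ : generator0 _ _ _ _ = exponent_re u); last first.
    rewrite /generator0 /exponent_re mul0r add0r; congr (_ + _); first by field.
    by congr fine; apply: eq_integral => x _; rewrite mul0r subr0.
  have /is_derive_cvg_at_right : is_derive (0 : R) 1
     (fun t => expR (t * exponent_re u) * cos (t * exponent_im u)) (exponent_re u).
    apply: is_derive_eq.
    by rewrite !mul0r sin0 cos0 expR0 /GRing.scale/=; ring.
  rewrite !mul0r cos0 expR0 mulr1; apply: cvg_trans; apply: near_eq_cvg.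
  near=> t; have /(_ t u)[|-> _//] := muE.
  by near: t; exact: nbhs_right_ge.
- rewrite (_ : generator0 _ _ _ _ = exponent_im u); last first.
    rewrite /generator0 /exponent_im !mul0r addr0 [drift * _]mulrC; congr (_ + _).
    by congr fine; apply: eq_integral => x _; rewrite subr0.
  have /is_derive_cvg_at_right : is_derive (0 : R) 1
     (fun t => expR (t * exponent_re u) * sin (t * exponent_im u)) (exponent_im u).
    apply: is_derive_eq.
    by rewrite !mul0r sin0 cos0 expR0 /GRing.scale/=; ring.
  rewrite !mul0r sin0 mulr0; apply: cvg_trans; apply: near_eq_cvg.
  near=> t; have /(_ t u)[|_ ->//] := muE.
  by near: t; exact: nbhs_right_ge.
- rewrite (_ : generator0 _ _ _ _ = c * generator0 G g0 g1 g2 + generator0 H h0 h1 h2); last first.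
    rewrite /generator0.
    rewrite (_ : Rintegral _ _ _ = c * \int[nu]_x (G x - g0 - g1 * small_part x) +
       \int[nu]_x (H x - h0 - h1 * small_part x)); first ring.
    rewrite -RintegralZl//; last exact: integrable_trigpoly_nu TG.
    rewrite -RintegralD//; last 2 first.
      - exact: integrableZl (integrable_trigpoly_nu TG).
      - exact: integrable_trigpoly_nu TH.
    by congr fine; apply: eq_integral => x _; congr (_%:E); ring.
  rewrite (_ : (fun t => _) = fun t => c * ((\int[mu t]_x G x - g0) / t) + (\int[mu t]_x H x - h0) / t).
    by apply: cvgD => //; apply: cvgM => //; exact: cvg_cst.
  apply/funext => t; rewrite RintegralD//.
  + rewrite RintegralZl//; last exact: integrable_trigpoly TG.
    by rewrite mulrA -mulrDl; congr (_ / _); ring.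
  + exact: integrableZl (integrable_trigpoly _ TG).
  + exact: integrable_trigpoly TH.
Unshelve. all: by end_near.
Qed.

End exponent.

Lemma near_at_right0P {R : realType} (P : R -> Prop) :
  (\forall t \near 0^'+, P t) <->
  exists2 t0 : R, 0 < t0 & forall t, 0 < t < t0 -> P t.
Proof.
split=> [[e /= e0 eP]|[t0 t00 tP]].
  exists e => // t /andP[t0 te]; apply: eP => //=.
  by rewrite sub0r normrN gtr0_norm.
near=> t; apply: tP; apply/andP; split; near: t; first exact: nbhs_right_gt.
exact: nbhs_right_lt.
Unshelve. all: by end_near.
Qed.

Lemma measurable_norm_gt {R : realType} (K : R) : measurable [set x : R | K < `|x|].
Proof.
rewrite (_ : [set _ | _] = (fun x : R => `|x|) @^-1` `]K, +oo[%classic).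
  by rewrite -[X in measurable X]setTI; exact: normr_measurable.
by apply/seteqP; split => x /=; rewrite in_itv/= andbT.
Qed.

(** * Small-time bounds from the characteristic function *)

Section tail.
Context {R : realType}.
Variables (sigma2 drift : R) (nu : {measure set R -> \bar R}).
Hypothesis sigma2_ge0 : 0 <= sigma2.
Hypothesis nuw : (\int[nu]_x (levy_weight x)%:E < +oo)%E.
Variable mu : R -> probability R R.
Hypothesis muE : has_exponent sigma2 drift nu mu.

Lemma integrable_indic_away (A : set R) (e : R) : 0 < e -> measurable A ->
  (forall x, A x -> e <= `|x|) -> nu.-integrable setT (EFin \o \1_A).
Proof.
move=> e0 mA Ae.
apply: (@integrable_dominated _ nu _ levy_weight (1 + e ^- 2)) => //; last exact: integrable_levy_weight.
move=> x; rewrite indicE; case: (boolP (x \in A)) => [/set_mem/Ae ex|_]; last first.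
  by rewrite normr0 mulr_ge0 ?levy_weight_ge0// addr_ge0// invr_ge0 exprn_ge0// ltW.
rewrite normr1; have [x1|/ltW x1] := leP `|x| 1; last first.
  by rewrite levy_weight_large// mulr1 lerDl invr_ge0 exprn_ge0// ltW.
rewrite levy_weight_small// -(real_normK (num_real x)).
rewrite (le_trans (y := e ^- 2 * e ^+ 2))//.
  by rewrite mulVf// expf_neq0// gt_eqF.
have ee : 0 <= e ^+ 2 by rewrite exprn_ge0// ltW.
apply: ler_pM; rewrite ?invr_ge0//.
- by rewrite lerDr.
- by rewrite lerXn2r ?nnegrE// ltW.
Qed.

(** Dominated convergence along [d = 1 / (n + 1)]. The bound [d <= e] serves to make the Gaussian
    contribution [sigma2 * d ^ 2] small at the same time. *)
Lemma levy_weightZ_small (e : R) : 0 < e ->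
  exists d : R, [/\ 0 < d <= 1, d <= e & \int[nu]_x levy_weight (d * x) <= e].
Proof.
move=> e0; pose f_ (n : nat) (x : R) : \bar R := (levy_weight (n.+1%:R^-1 * x))%:E.
have mf_ n : measurable_fun setT (f_ n).
  by apply/measurable_EFinP; apply: measurableT_comp; [exact: measurable_levy_weight|].
have fg n x : (`|f_ n x| <= (EFin \o levy_weight) x)%E.
  rewrite /f_ /= lee_fin ger0_norm ?levy_weight_ge0//.
  rewrite le_min ge_min ge_min lexx orbT andbT; apply/orP; left.
  by rewrite exprMn ler_piMl ?sqr_ge0// expr_le1 ?invr_ge0// invf_le1 ?ltr0n// ler1n.
have f0 x : f_ ^~ x @ \oo --> 0%E.
  apply/fine_cvgP; split; first exact: nearW.
  apply: (@squeeze_cvgr _ _ _ _ (cst 0) (fun n => n.+1%:R^-1 * x ^+ 2)).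
  - near=> n; rewrite /= levy_weight_ge0/= ge_min; apply/orP; left.
    by rewrite exprMn ler_wpM2r ?sqr_ge0// expr2 ler_piMl ?invr_ge0// invf_le1 ?ltr0n// ler1n.
  - exact: cvg_cst.
  - rewrite -[X in _ --> X](mul0r (x ^+ 2)); apply: cvgM; last exact: cvg_cst.
    exact: cvg_harmonic.
have [_ _] := dominated_convergence measurableT mf_ (measurable_cst 0%E)
  (aeW _ (fun x _ => f0 x)) (integrable_levy_weight nuw) (aeW _ (fun x n _ => fg n x)).
rewrite integral0 => /fine_cvgP[_ /cvgrPdist_le /(_ e e0) fe].
have he : \forall n \near \oo, n.+1%:R^-1 <= e.
  have /cvgrPdist_le/(_ e e0) := @cvg_harmonic R.
  apply: filterS => n; rewrite sub0r normrN; exact: le_trans (ler_norm _).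
have [n _ /(_ n (leqnn n)) [/= h1 h2]] := filterI fe he.
exists n.+1%:R^-1; split=> //.
  by rewrite invr_gt0 ltr0n invf_le1 ?ltr0n// ler1n.
by move: h1; rewrite sub0r normrN; exact: le_trans (ler_norm _).
Unshelve. all: by end_near.
Qed.

Lemma integrable_cosB1 u : nu.-integrable setT (EFin \o (fun x => cos (u * x) - 1)).
Proof.
apply: (@integrable_dominated _ nu _ levy_weight (u ^+ 2 + 2)); last exact: integrable_levy_weight.
  by apply: measurable_funB => //; exact: measurable_cosZ.
exact: norm_cosB1_le.
Qed.

Lemma integrable_sinB u : nu.-integrable setT (EFin \o (fun x => sin (u * x) - u * small_part x)).
Proof.
apply: (@integrable_dominated _ nu _ levy_weight (`|u| ^+ 3 + 1)); last exact: integrable_levy_weight.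
  apply: measurable_funB; first exact: measurable_sinZ.
  by apply: measurable_funM => //; exact: measurable_small_part.
exact: norm_sinB_small_part_le.
Qed.

Lemma integrable_levy_weightZ d : d ^+ 2 <= 1 ->
  nu.-integrable setT (EFin \o (fun x => levy_weight (d * x))).
Proof.
move=> d1; apply: (@integrable_dominated _ nu _ levy_weight 1); last exact: integrable_levy_weight.
  by apply: measurableT_comp; [exact: measurable_levy_weight|].
move=> x; rewrite mul1r ger0_norm ?levy_weight_ge0//.
rewrite le_min ge_min ge_min lexx orbT andbT; apply/orP; left.
by rewrite exprMn ler_piMl ?sqr_ge0.
Qed.

Lemma exponent_re_le0 u : exponent_re sigma2 nu u <= 0.
Proof.
rewrite /exponent_re -[leRHS]addr0 lerD//.
  by rewrite oppr_le0 mulr_ge0// mulr_ge0// sqr_ge0.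
rewrite -oppr_ge0 -(mulN1r (Rintegral _ _ _)) -RintegralZl//; last exact: integrable_cosB1.
by apply: Rintegral_ge0 => x _; rewrite mulN1r opprB subr_ge0 cos_le1.
Qed.

(** Uniform in [u], so that it survives averaging over [[0, d]]; it rests on
    [1 - cos z <= 2 min (z ^ 2, 1)]. *)
Lemma exponent_re_ge d u : 0 <= u <= d -> d <= 1 ->
  - exponent_re sigma2 nu u <= sigma2 * d ^+ 2 / 2 + 2 * \int[nu]_x levy_weight (d * x).
Proof.
move=> /andP[u0 ud] d1; have d0 := le_trans u0 ud.
rewrite /exponent_re opprD opprK lerD//.
  by rewrite ler_wpM2r// ler_wpM2l// lerXn2r.
have dd : d ^+ 2 <= 1 by rewrite expr_le1.
rewrite -(mulN1r (Rintegral _ _ _)) -RintegralZl//; last exact: integrable_cosB1.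
rewrite -RintegralZl//; last exact: integrable_levy_weightZ.
apply: le_Rintegral => //.
- exact: integrableZl (integrable_cosB1 u).
- exact: integrableZl (integrable_levy_weightZ dd).
move=> x _; rewrite mulN1r opprB; have := ler_1Bcos (u * x); have := cos_geN1 (u * x).
have : (u * x) ^+ 2 <= (d * x) ^+ 2 by rewrite !exprMn ler_wpM2r ?sqr_ge0// lerXn2r.
rewrite /levy_weight; have := sqr_ge0 (d * x); set c := cos _.
by rewrite minEle; case: ifPn => _; lra.
Qed.

Lemma exponent_im_bounded : exists M, forall u, 0 <= u <= 1 -> `|exponent_im drift nu u| <= M.
Proof.
exists (`|drift| + 2 * \int[nu]_x levy_weight x) => u /andP[u0 u1].
rewrite /exponent_im (le_trans (ler_normD _ _))// lerD//.
  by rewrite normrM ler_piMr// ger0_norm.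
rewrite (le_trans (le_normr_Rintegral _ (integrable_sinB u)))//.
rewrite -RintegralZl//; last exact: integrable_levy_weight.
apply: le_Rintegral => //.
- exact: integrable_norm (integrable_sinB u).
- exact: integrableZl (integrable_levy_weight nuw).
move=> x _; rewrite (le_trans (norm_sinB_small_part_le _ _))// ler_wpM2r ?levy_weight_ge0//.
have : `|u| ^+ 3 <= 1 by rewrite expr_le1// ger0_norm.
lra.
Qed.

(** Write [1 - e^x cos y] as [1 - e^x] plus [e^x (1 - cos y)] with [x <= 0]: the first term is at
    most [- x], the second at most [y ^ 2 / 2]. *)
Lemma chf_bound (t u : R) : 0 <= t ->
  \int[mu t]_x (1 - cos (u * x)) <=
  t * - exponent_re sigma2 nu u + (t * exponent_im drift nu u) ^+ 2 / 2.
Proof.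
move=> t0; rewrite RintegralB//; last 2 first.
  by apply: (@bounded_integrable _ _ _ _ _ 1) => // x; rewrite normr1.
  exact: integrable_trigpoly (trigpoly_cos _).
rewrite Rintegral_cst_probability; have [-> _] := muE u t0.
set r := exponent_re _ _ _; set m := exponent_im _ _ _.
have r0 : r <= 0 by exact: exponent_re_le0.
have h1 := expR_ge1Dx (t * r); have h2 := ler_1Bcos (t * m).
have h3 : expR (t * r) <= 1 by rewrite expR_le1 mulr_ge0_le0.
have h4 := expR_gt0 (t * r).
have : expR (t * r) * (1 - cos (t * m)) <= 1 * ((t * m) ^+ 2 / 2).
  by rewrite ler_pM// ?ltW// subr_ge0 cos_le1.
lra.
Qed.

Lemma integral_1Bcos (d x : R) : 0 < d -> x != 0 ->
  (\int[lebesgue_measure]_(u in `[0%R, d]) (1 - cos (u * x))%:E = (d - sin (d * x) / x)%:E)%E.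
Proof.
move=> d0 x0.
have cu (u : R) : sin (v * x) / x @[v --> u] --> sin (u * x) / x.
  apply: cvgM; last exact: cvg_cst.
  by apply: continuous_comp; [exact: mulrr_continuous|exact: continuous_sin].
have dF (u : R) : is_derive u (1 : R) (fun u => u - sin (u * x) * x^-1) (1 - cos (u * x)).
  apply: is_derive_eq; rewrite /GRing.scale/=; field; exact: x0.
rewrite (@continuous_FTC2 _ (fun u => 1 - cos (u * x)) (fun u => u - sin (u * x) / x))//.
- by rewrite mul0r sin0 mul0r subr0 sube0.
- apply: continuous_subspaceT => u; apply: cvgB; first exact: cvg_cst.
  by apply: continuous_comp; [exact: mulrr_continuous|exact: continuous_cos].
- split=> [u _||].
  + by have [] := dF u.
  + by apply: cvg_at_right_filter; apply: cvgB => //; exact: cu.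
  + by apply: cvg_at_left_filter; apply: cvgB => //; exact: cu.
- by move=> u _; rewrite derive1E; have [_ ->] := dF u.
Qed.

(* Truncation inequality: average [1 - cos (u * x)] over [u] from 0 to [d]. *)
Lemma tail_bound (d t : R) (M : R) : 0 < d <= 1 -> 0 <= t ->
  (forall u, 0 <= u <= 1 -> `|exponent_im drift nu u| <= M) ->
  fine (mu t [set x | 2 / d < `|x|]) <=
  2 * t * (sigma2 * d ^+ 2 / 2 + 2 * \int[nu]_x levy_weight (d * x) + t * M ^+ 2 / 2).
Proof.
move=> /andP[d0 d1] t0 Mu.
set B := _ + t * M ^+ 2 / 2.
pose f (z : R * measurableTypeR R) : \bar R := ((1 - cos (z.2 * z.1)) * \1_(`[0, d]%classic) (z.2 : R))%:E.
have mf : measurable_fun setT f.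
  apply/measurable_EFinP; apply: measurable_funM.
    apply: measurable_funB => //; apply: measurableT_comp.
      by apply: continuous_measurable_fun; exact: continuous_cos.
    by apply: measurable_funM; [exact: measurable_snd|exact: measurable_fst].
  by apply: measurableT_comp; [exact: measurable_indic|exact: measurable_snd].
have f0 z : (0 <= f z)%E by rewrite lee_fin mulr_ge0// subr_ge0 cos_le1.
have := @fubini_tonelli _ _ _ _ _ (mu t) (@lebesgue_measure R) f mf f0 => FT.
have mA : measurable [set x : R | 2 / d < `|x|] by exact: measurable_norm_gt.
have fE x : (\int[lebesgue_measure]_u f (x, u) =
    \int[lebesgue_measure]_(u in `[0%R, d]) (1 - cos (u * x))%:E)%E.
  rewrite [RHS]integral_mkcond; apply: eq_integral => u _.
  by rewrite /f /= patchE indicE; case: ifP => _; rewrite ?mulr1 ?mulr0.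
(* For [|x| > 2 / d] the average over [u], which is [1 - sin (d x) / (d x)], is at least [1 / 2]. *)
have lhs : ((d / 2 * fine (mu t [set x | (2 / d < `|x|)%R])%R)%:E <= \int[mu t]_x \int[lebesgue_measure]_u f (x, u))%E.
  set A := [set x | _] in mA *.
  rewrite EFinM (_ : (fine (mu t A))%:E = (\int[mu t]_x (\1_A x)%:E)%E); last first.
    by rewrite integral_indic// setIT fineK// fin_num_measure.
  rewrite -ge0_integralZl//; last first.
  - by rewrite lee_fin divr_ge0// ltW.
  - exact/measurable_EFinP.
  apply: ge0_le_integral => //.
  - by move=> x _; rewrite mule_ge0// lee_fin divr_ge0// ltW.
  - by apply/measurable_EFinP; apply: measurable_funM => //; exact: measurable_indic.
  - exact: measurable_fun_fubini_tonelli_F.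
  move=> x _; rewrite indicE; case: (boolP (x \in _)) => [/set_mem/= xd|_]; last first.
    by rewrite mule0; exact: integral_ge0.
  have x0 : 0 < `|x| by rewrite (lt_trans _ xd)// divr_gt0.
  rewrite mule1 fE integral_1Bcos// -?normr_gt0// lee_fin.
  have : `|sin (d * x) / x| <= d / 2.
    rewrite normrM normfV ler_pdivrMr// (le_trans (sin_max _))//.
    by rewrite -ler_pdivrMl ?divr_gt0// mulr1 invf_div ltW.
  by move=> /ler_normlW; lra.
have rhs : (\int[lebesgue_measure]_u \int[mu t]_x f (x, u) <= (t * B * d)%:E)%E.
  have B0 : 0 <= B.
    rewrite addr_ge0// ?addr_ge0//.
    - by rewrite divr_ge0// mulr_ge0// sqr_ge0.
    - by rewrite mulr_ge0// Rintegral_ge0// => x _; exact: levy_weight_ge0.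
    - by rewrite divr_ge0// mulr_ge0// sqr_ge0.
  apply: (@le_trans _ _ (\int[lebesgue_measure]_u ((t * B)%:E * (\1_(`[0, d]%classic) u)%:E))%E).
    apply: ge0_le_integral => //.
    - by move=> u _; exact: integral_ge0.
    - exact: measurable_fun_fubini_tonelli_G.
    - by apply/measurable_EFinP; apply: measurable_funM => //; exact: measurable_indic.
    move=> u _; rewrite /f /= indicE; case: (boolP (u \in _)) => [/set_mem/=|_]; last first.
      by rewrite mule0 integral0_eq// => x _; rewrite mulr0.
    rewrite in_itv/= => /andP[u0 ud]; rewrite mule1.
    under eq_integral do rewrite mulr1.
    have ic : (mu t).-integrable setT (EFin \o (fun x => 1 - cos (u * x))).
      apply: (@bounded_integrable _ _ _ _ _ 2).
        by apply: measurable_funB => //; exact: measurable_cosZ.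
      by move=> x; rewrite ger0_norm ?subr_ge0 ?cos_le1//; have := cos_geN1 (u * x); lra.
    rewrite -[leLHS]fineK; last exact: integrable_fin_num ic.
    rewrite lee_fin (le_trans (chf_bound _ t0))//.
    have u01 : 0 <= u <= 1 by rewrite u0 (le_trans ud).
    have h1 : t * - exponent_re sigma2 nu u <= t * (sigma2 * d ^+ 2 / 2 + 2 * \int[nu]_x levy_weight (d * x)).
      by rewrite ler_wpM2l// exponent_re_ge// u0.
    have h2 : (t * exponent_im drift nu u) ^+ 2 <= t ^+ 2 * M ^+ 2.
      rewrite exprMn ler_wpM2l ?sqr_ge0// -(real_normK (num_real (exponent_im _ _ _))).
      by rewrite lerXn2r ?nnegrE ?Mu// (le_trans _ (Mu u u01)).
    have -> : t * B = t * (sigma2 * d ^+ 2 / 2 + 2 * \int[nu]_x levy_weight (d * x)) +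
        t ^+ 2 * M ^+ 2 / 2 by rewrite /B; ring.
    by rewrite lerD// ler_wpM2r.
  rewrite ge0_integralZl//; last 2 first.
  - by apply/measurable_EFinP; exact: measurable_indic.
  - by rewrite lee_fin mulr_ge0.
  rewrite [X in (_ * X)%E](_ : _ = d%:E)// integral_indic// setIT.
  have := @lebesgue_measure_itv R `[0, d].
  by rewrite /= lte_fin d0 -EFinD subr0.
have := le_trans lhs; rewrite FT => /(_ _ rhs); rewrite lee_fin => h.
rewrite -(ler_pM2l d0); lra.
Qed.

End tail.

Lemma cvg_at_right0_bounded {R : realType} (g : R -> R) (l : R) :
  g t @[t --> (0 : R)^'+] --> l -> exists2 C, 0 < C & \forall t \near (0 : R)^'+, `|g t| <= C.
Proof.
move=> gl; exists (`|l| + 1); first by rewrite ltr_wpDl.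
have /cvgrPdist_le/(_ 1 ltr01) := gl; apply: filterS => t.
rewrite distrC => h; rewrite -[g t](subrK l) (le_trans (ler_normD _ _))// addrC.
by rewrite lerD2l.
Qed.

Lemma ge_sin_sqr {R : realType} (x : R) : `|x| <= 1 -> x ^+ 2 <= 4 * sin x ^+ 2.
Proof.
wlog x0 : x / 0 <= x.
  move=> H; have [/H//|/ltW x0 x1] := leP 0 x.
  have := H (- x); rewrite oppr_ge0 normrN sinN !sqrrN; exact.
rewrite ger0_norm// => x1; have : x / 2 <= sin x by rewrite sin_ge_half// x0.
move=> h; have : (x / 2) ^+ 2 <= sin x ^+ 2 by rewrite lerXn2r ?nnegrE//; lra.
lra.
Qed.

Section small_time.
Context {R : realType}.
Variables (sigma2 drift : R) (nu : {measure set R -> \bar R}).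
Hypothesis sigma2_ge0 : 0 <= sigma2.
Hypothesis nuw : (\int[nu]_x (levy_weight x)%:E < +oo)%E.
Variable mu : R -> probability R R.
Hypothesis muE : has_exponent sigma2 drift nu mu.

(** Tightness of [mu_t / t] at infinity, with [K = 2 / d]. In [tail_bound], a small [d] shrinks the
    Gaussian and the jump term, and a small [t] the term coming from the imaginary part. *)
Lemma tail_small (e : R) : 0 < e -> exists2 K, 0 < K &
  fine (nu [set x | K < `|x|]) <= e /\
  \forall t \near (0 : R)^'+, fine (mu t [set x | K < `|x|]) <= e * t.
Proof.
move=> e0; have [M MM] := exponent_im_bounded drift nuw.
(* The inequality to reach is [sigma2 * d ^ 2 + 4 * W + t * M ^ 2 <= e]; the first two terms are at
   most [e' * (sigma2 + 4) <= e / 2]. *)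
pose e' := Num.min e (e / (2 * (sigma2 + 4))).
have s4 : 0 < 2 * (sigma2 + 4) by rewrite mulr_gt0// ltr_wpDl.
have e'0 : 0 < e' by rewrite lt_min e0 divr_gt0.
have e'e : e' * (sigma2 + 4) <= e / 2.
  have : e' <= e / (2 * (sigma2 + 4)) by rewrite ge_min lexx orbT.
  by rewrite ler_pdivlMr// => ?; lra.
have [d [d01 de dW]] := levy_weightZ_small nuw e'0.
have /andP[d0 d1] := d01.
exists (2 / d); first by rewrite divr_gt0.
split.
  have mA : measurable [set x : R | 2 / d < `|x|] by exact: measurable_norm_gt.
  have dd : d ^+ 2 <= 1 by rewrite expr_le1// ltW.
  rewrite (_ : fine _ = \int[nu]_x \1_[set x | 2 / d < `|x|] x); last first.
    by rewrite /Rintegral integral_indic// setIT.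
  apply: (@le_trans _ _ e'); last by rewrite ge_min lexx.
  apply: le_trans dW; apply: le_Rintegral => //.
  - apply: (integrable_indic_away nuw (divr_gt0 (ltr0n R 2) d0) mA) => x /=.
    exact: ltW.
  - exact: integrable_levy_weightZ.
  - move=> x _; rewrite indicE; case: (boolP (x \in _)) => [/set_mem/= xd|_]; last exact: levy_weight_ge0.
    rewrite levy_weight_large// normrM gtr0_norm// -ler_pdivrMl// mulr1.
    by rewrite (le_trans _ (ltW xd))// -[leLHS]mul1r ler_pM2r ?invr_gt0// ler1n.
near=> t.
have t0 : 0 < t by near: t; exact: nbhs_right_gt.
have tM : t * M ^+ 2 <= e / 2.
  rewrite (le_trans (y := t * (M ^+ 2 + 1)))//.
    by rewrite ler_wpM2l ?ltW// ltrDl.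
  rewrite -ler_pdivlMr ?ltr_wpDl ?sqr_ge0//; apply: ltW; near: t; apply: nbhs_right_lt.
  by rewrite !divr_gt0// ltr_wpDl ?sqr_ge0.
rewrite (le_trans (tail_bound sigma2_ge0 nuw muE d01 (ltW t0) MM))//.
have h1 : sigma2 * d ^+ 2 <= sigma2 * e'.
  by rewrite ler_wpM2l// (le_trans _ de)// expr2 ler_piMl// ltW.
move: dW; set W := Rintegral _ _ _ => dW.
have : t * (2 * (sigma2 * d ^+ 2 / 2 + 2 * W + t * M ^+ 2 / 2)) <= t * e.
  by rewrite ler_pM2l//; lra.
lra.
Unshelve. all: by end_near.
Qed.

Lemma sin_sqr_bounded u : exists2 C, 0 < C &
  \forall t \near (0 : R)^'+, \int[mu t]_x (sin (u * x) ^+ 2) <= C * t.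
Proof.
have /cvg_at_right0_bounded[C C0 HC] := trigpoly_generator nuw muE (trigpoly_sinX u 0).
exists C => //; near=> t.
have t0 : 0 < t by near: t; exact: nbhs_right_gt.
rewrite -ler_pdivrMr// (le_trans (ler_norm _))//; near: t.
by apply: filterS HC => t; rewrite subr0.
Unshelve. all: by end_near.
Qed.

Lemma integrable_sinX (m : probability R R) u k :
  m.-integrable setT (EFin \o (fun x => sin (u * x) ^+ k)).
Proof.
apply: (@bounded_integrable _ _ _ _ _ 1).
  by apply: measurable_funX; exact: measurable_sinZ.
by move=> x; rewrite normrX exprn_ile1// sin_max.
Qed.

(** Beyond [K] this is [tail_small]. For [e < |x| <= K], [sin (x / K) ^ 2] is at least
    [e ^ 2 / (4 K ^ 2)], and its mean is [O(t)] by the generator limit. *)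
Lemma jump_bound (e : R) : 0 < e -> exists2 C, 0 < C &
  \forall t \near (0 : R)^'+, fine (mu t [set x | e < `|x|]) <= C * t.
Proof.
move=> e0; have [K K0 [_ HK]] := tail_small (@ltr01 R).
have [C C0 HC] := sin_sqr_bounded K^-1.
have c0 : 0 < 4 * K ^+ 2 / e ^+ 2 by rewrite divr_gt0 ?mulr_gt0 ?exprn_gt0.
exists (1 + 4 * K ^+ 2 / e ^+ 2 * C); first by rewrite addr_gt0// mulr_gt0.
near=> t.
have t0 : 0 < t by near: t; exact: nbhs_right_gt.
have me := @measurable_norm_gt R e; have mK := @measurable_norm_gt R K.
rewrite -Rintegral_indic// mulrDl.
apply: (@le_trans _ _ (\int[mu t]_x (\1_[set x | K < `|x|] x + 4 * K ^+ 2 / e ^+ 2 * sin (K^-1 * x) ^+ 2))).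
  apply: le_Rintegral => //.
  - exact: integrable_indicR.
  - apply: integrable_addR; first exact: integrable_indicR.
    by apply: integrable_scaleR; exact: integrable_sinX.
  - move=> x _; rewrite !indicE; case: (boolP (x \in [set x | e < _])) => [/set_mem/= ex|_]; last first.
      by rewrite addr_ge0// mulr_ge0 ?sqr_ge0// ltW.
    case: (boolP (x \in [set x | K < _])) => [_|/negP xK].
      by rewrite lerDl mulr_ge0 ?sqr_ge0// ltW.
    have {}xK : `|x| <= K by rewrite leNgt; apply/negP => h; apply: xK; rewrite inE.
    have : `|K^-1 * x| <= 1 by rewrite normrM gtr0_norm ?invr_gt0// ler_pdivrMl// mulr1.
    move=> /ge_sin_sqr h; rewrite add0r.
    rewrite -mulrA [_ ^- 2 * _]mulrC mulrA ler_pdivlMr ?exprn_gt0// mul1r.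
    rewrite mulrAC -ler_pdivrMr ?exprn_gt0//; apply: le_trans h.
    rewrite exprMn exprVn mulrC ler_wpM2l ?invr_ge0 ?sqr_ge0//.
    by rewrite -(real_normK (num_real x)) lerXn2r ?nnegrE// ltW.
rewrite RintegralD//; last 2 first.
- exact: integrable_indicR.
- by apply: integrable_scaleR; exact: integrable_sinX.
rewrite Rintegral_indic// RintegralZl//; last exact: integrable_sinX.
rewrite lerD//; first by near: t.
by rewrite -[_ * C * t]mulrA ler_pM2l//; near: t.
Unshelve. all: by end_near.
Qed.

Lemma measurable_norm_le (e : R) : measurable [set x : R | `|x| <= e].
Proof.
rewrite (_ : [set _ | _] = ~` [set x | e < `|x|]).
  by apply: measurableC; exact: measurable_norm_gt.
by apply/seteqP; split => x /=; rewrite leNgt => /negP.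
Qed.

Lemma second_moment_bound (e : R) : 0 < e <= 1 -> exists2 C, 0 < C &
  \forall t \near (0 : R)^'+, \int[mu t]_x (x ^+ 2 * \1_[set x | `|x| <= e] x) <= C * t.
Proof.
move=> /andP[e0 e1]; have [C C0 HC] := sin_sqr_bounded 1.
exists (4 * C); first by rewrite mulr_gt0.
near=> t; rewrite -mulrA (@le_trans _ _ (4 * \int[mu t]_x (sin (1 * x) ^+ 2)))//; last first.
  by rewrite ler_pM2l//; near: t.
rewrite -RintegralZl//; last exact: integrable_sinX.
have me := measurable_norm_le e.
apply: le_Rintegral => //.
- apply: (@bounded_integrable _ _ _ _ _ 1).
    by apply: measurable_funM; [exact: measurable_funX|exact: measurable_indic].
  move=> x; rewrite indicE; case: (boolP (x \in _)) => [/set_mem/= xe|_]; last by rewrite mulr0 normr0.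
  by rewrite mulr1 normrX expr_le1// (le_trans xe).
- by apply: integrable_scaleR; exact: integrable_sinX.
- move=> x _; rewrite indicE; case: (boolP (x \in _)) => [/set_mem/= xe|_].
    by rewrite mulr1 mul1r ge_sin_sqr// (le_trans xe).
  by rewrite mulr0 mulr_ge0// sqr_ge0.
Unshelve. all: by end_near.
Qed.

(** The mean of [sin] is [O(t)] by the generator limit. It differs from the truncated mean by at
    most the mass of [|x| > e] plus the truncated second moment, because
    [|sin x - x| <= |x| ^ 3 / 2]. *)
Lemma first_moment_bound (e : R) : 0 < e <= 1 -> exists2 C, 0 < C &
  \forall t \near (0 : R)^'+, `|\int[mu t]_x (x * \1_[set x | `|x| <= e] x)| <= C * t.
Proof.
move=> /[dup] e01 /andP[e0 e1].
have [C1 C10 H1] := jump_bound e0; have [C2 C20 H2] := second_moment_bound e01.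
have /cvg_at_right0_bounded[C3 C30 H3] := trigpoly_generator nuw muE (trigpoly_sin 1).
exists (C1 + C2 + C3); first by rewrite !addr_gt0.
have me := measurable_norm_le e; have me' := @measurable_norm_gt R e.
near=> t; have t0 : 0 < t by near: t; exact: nbhs_right_gt.
pose g x := (x - sin x) * \1_[set x | `|x| <= e] x - sin x * \1_[set x | e < `|x|] x.
have ix : (mu t).-integrable setT (EFin \o (fun x => x * \1_[set x | `|x| <= e] x)).
  apply: (@bounded_integrable _ _ _ _ _ 1).
    by apply: measurable_funM => //; exact: measurable_indic.
  move=> x; rewrite indicE; case: (boolP (x \in _)) => [/set_mem/= xe|_]; last by rewrite mulr0 normr0.
  by rewrite mulr1 (le_trans xe).
have is1 := integrable_trigpoly (mu t) (trigpoly_sin 1).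
have E x : x * \1_[set x | `|x| <= e] x - sin (1 * x) = g x.
  rewrite /g mul1r !indicE; have [xe|xe] := leP `|x| e.
    rewrite !(mem_set (A := [set x | `|x| <= e])) ?memNset//=.
      by ring.
    by rewrite ltNge xe.
  rewrite (memNset (A := [set x | `|x| <= e])) ?mem_set//=; first by ring.
  by rewrite leNgt xe.
have ig : (mu t).-integrable setT (EFin \o g).
  have := integrableB measurableT ix is1.
  by apply: eq_integrable => // x _ /=; rewrite -E.
have -> : \int[mu t]_x (x * \1_[set x | `|x| <= e] x) = \int[mu t]_x g x + \int[mu t]_x sin (1 * x).
  rewrite -RintegralD//; congr fine; apply: eq_integral => x _.
  by rewrite -E subrK.
rewrite (le_trans (ler_normD _ _))// mulrDl lerD//; last first.
  rewrite -ler_pdivrMr// -[t in _ / t](gtr0_norm t0) -normf_div.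
  by near: t; apply: filterS H3 => t; rewrite subr0.
rewrite (le_trans (le_normr_Rintegral _ ig))//.
have isq : (mu t).-integrable setT (EFin \o (fun x => x ^+ 2 * \1_[set x | `|x| <= e] x)).
  apply: (@bounded_integrable _ _ _ _ _ 1).
    by apply: measurable_funM; [exact: measurable_funX|exact: measurable_indic].
  move=> x; rewrite indicE; case: (boolP (x \in _)) => [/set_mem/= xe|_]; last by rewrite mulr0 normr0.
  by rewrite mulr1 normrX expr_le1// (le_trans xe).
apply: (@le_trans _ _ (\int[mu t]_x (\1_[set x | e < `|x|] x + x ^+ 2 * \1_[set x | `|x| <= e] x))).
  apply: le_Rintegral => //.
  - exact: integrable_norm ig.
  - by apply: integrable_addR => //; exact: integrable_indicR.
  - move=> x _; rewrite /g (le_trans (ler_normB _ _))// addrC lerD// normrM.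
    + by rewrite [X in _ * X]ger0_norm// ler_piMl// sin_max.
    + rewrite [X in _ * X]ger0_norm// indicE; case: (boolP (x \in _)) => [/set_mem/= xe|_]; last by rewrite !mulr0.
      rewrite !mulr1 distrC (le_trans (ler_norm_sinB _))// -(real_normK (num_real x)).
      rewrite exprS; have := le_trans xe e1 => x1.
      have := exprn_ge0 2 (normr_ge0 x) => h.
      have : `|x| * `|x| ^+ 2 <= 1 * `|x| ^+ 2 by rewrite ler_wpM2r.
      by move=> ?; lra.
rewrite RintegralD//; last exact: integrable_indicR.
by rewrite Rintegral_indic// mulrDl lerD//; near: t.
Unshelve. all: by end_near.
Qed.

End small_time.

Definition bounded_lipschitz {R : realType} (f : R -> R) :=
  exists M L, [/\ 0 <= M, 0 <= L, forall x, `|f x| <= M &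
    forall x y, `|f x - f y| <= L * `|x - y|].

(** * Small-time limits of tail probabilities *)

Section bounded_lipschitz.
Context {R : realType}.
Implicit Types f g : R -> R.

Lemma bounded_lipschitzM f g : bounded_lipschitz f -> bounded_lipschitz g ->
  bounded_lipschitz (fun x => f x * g x).
Proof.
move=> [M [L [M0 L0 fM fL]]] [N [K [N0 K0 gN gK]]].
exists (M * N), (M * K + N * L); split; rewrite ?addr_ge0 ?mulr_ge0//.
  by move=> x; rewrite normrM ler_pM.
move=> x y.
rewrite (_ : _ - _ = f x * (g x - g y) + g y * (f x - f y)); last by ring.
rewrite (le_trans (ler_normD _ _))// !normrM mulrDl -!mulrA lerD//; exact: ler_pM.
Qed.

Lemma measurable_lipschitz f L : (forall x y, `|f x - f y| <= L * `|x - y|) ->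
  measurable_fun setT f.
Proof.
move=> fL; apply: continuous_measurable_fun => x; apply/cvgrPdist_le => e e0.
near=> y; rewrite (le_trans (fL x y))//.
have L1 : 0 < `|L| + 1 by rewrite ltr_wpDl.
rewrite (@le_trans _ _ ((`|L| + 1) * `|x - y|))//.
  by rewrite ler_wpM2r// (le_trans (ler_norm _))// lerDl.
rewrite -ler_pdivlMl// mulrC; near: y.
by apply: cvgr_dist_le; [exact: cvg_id|rewrite divr_gt0].
Unshelve. all: by end_near.
Qed.

Definition ramp (a b v : R) : R := Num.max 0 (Num.min 1 ((v - a) / (b - a))).

Lemma ramp_ge0 a b v : 0 <= ramp a b v.
Proof. by rewrite le_max lexx. Qed.

Lemma ramp_le1 a b v : ramp a b v <= 1.
Proof. by rewrite ge_max ler01 ge_min lexx. Qed.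

Lemma ramp_eq0 a b v : a < b -> v <= a -> ramp a b v = 0.
Proof.
move=> ab va; apply/max_idPl; rewrite ge_min; apply/orP; right.
by rewrite mulr_le0_ge0 ?invr_ge0 ?subr_le0 ?subr_ge0// ltW.
Qed.

Lemma ramp_eq1 a b v : a < b -> b <= v -> ramp a b v = 1.
Proof.
move=> ab bv; rewrite /ramp (min_idPl _); first by apply/max_idPr.
by rewrite ler_pdivlMr ?subr_gt0// mul1r lerD2r.
Qed.

Lemma bounded_lipschitz_ramp a b : a < b -> bounded_lipschitz (ramp a b).
Proof.
move=> ab; exists 1, (b - a)^-1; split => //.
- by rewrite invr_ge0 subr_ge0 ltW.
- by move=> x; rewrite ger0_norm ?ramp_le1// ramp_ge0.
have H v w : v <= w -> `|Num.max 0 (Num.min 1 v) - Num.max 0 (Num.min 1 w)| <= w - v :> R.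
  move=> vw; rewrite distrC ler_norml !maxEle !minEle.
  by case: (leP 1 w) => ?; case: (leP 1 v) => ?; rewrite ?ler01;
    case: (leP 0 w) => ?; case: (leP 0 v) => ?; apply/andP; split; lra.
move=> x y; wlog xy : x y / x <= y.
  by move=> K; have [/K//|/ltW/K] := leP x y; rewrite distrC [`|y - x|]distrC.
rewrite (le_trans (H _ _ _))//.
  by rewrite ler_wpM2r ?invr_ge0 ?subr_ge0 ?(ltW ab)// lerD2r.
by rewrite -mulrBl mulrC distrC ger0_norm ?subr_ge0// (_ : y - a - _ = y - x)//; ring.
Qed.

(** Capping below by [a] makes the reciprocal Lipschitz on the whole line; it still equals [1 / v]
    wherever [ramp a b] is nonzero. *)
Lemma bounded_lipschitz_inv a : 0 < a -> bounded_lipschitz (fun v : R => (Num.max v a)^-1).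
Proof.
move=> a0; have mx v : a <= Num.max v a by rewrite le_max lexx orbT.
have mx0 v : 0 < Num.max v a by exact: lt_le_trans (mx v).
exists a^-1, (a^-1 * a^-1); split; rewrite ?mulr_ge0 ?invr_ge0 ?ltW//.
  by move=> v; rewrite gtr0_norm ?invr_gt0// lef_pV2 ?posrE.
move=> x y.
have -> : (Num.max x a)^-1 - (Num.max y a)^-1 =
    (Num.max y a - Num.max x a) * ((Num.max x a)^-1 * (Num.max y a)^-1).
  by field; rewrite !gt_eqF.
rewrite normrM mulrC ler_pM//.
  rewrite ger0_norm; last by rewrite mulr_ge0// invr_ge0 ltW.
  by apply: ler_pM; rewrite ?invr_ge0 ?(ltW (mx0 _))// lef_pV2 ?posrE.
rewrite distrC ler_norml !maxEle; apply/andP; split.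
  by have := normr_ge0 (x - y); have := ler_norm (- (x - y)); rewrite normrN; case: (leP x a) => ?; case: (leP y a) => ?; lra.
by have := normr_ge0 (x - y); have := ler_norm (x - y); case: (leP x a) => ?; case: (leP y a) => ?; lra.
Qed.

End bounded_lipschitz.

Section tail_limit.
Context {R : realType}.
Variables (sigma2 drift : R) (nu : {measure set R -> \bar R}).
Hypothesis sigma2_ge0 : 0 <= sigma2.
Hypothesis nuw : (\int[nu]_x (levy_weight x)%:E < +oo)%E.
Variable mu : R -> probability R R.
Hypothesis muE : has_exponent sigma2 drift nu mu.

Lemma integrable_sin_sqr_nu u : nu.-integrable setT (EFin \o (fun x => sin (u * x) ^+ 2)).
Proof.
have := integrable_trigpoly_nu nuw (trigpoly_sinX u 0).
by apply: eq_integrable => // x _; rewrite /= mul0r !subr0.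
Qed.

Lemma integrable_sin_sqrM (m : {measure set R -> \bar R}) (u : R) (g : R -> R) M :
  m.-integrable setT (EFin \o (fun x => sin (u * x) ^+ 2)) ->
  measurable_fun setT g -> (forall v, -1 <= v <= 1 -> `|g v| <= M) ->
  m.-integrable setT (EFin \o (fun x => sin (u * x) ^+ 2 * g (sin (u * x)))).
Proof.
move=> im mg gM; apply: (@integrable_dominated _ m _ _ M _ _ im).
  apply: measurable_funM; first by apply: measurable_funX; exact: measurable_sinZ.
  by apply: measurableT_comp => //; exact: measurable_sinZ.
move=> x; rewrite normrM ger0_norm ?sqr_ge0// mulrC ler_wpM2r ?sqr_ge0//.
by rewrite gM// sin_geN1 sin_le1.
Qed.

Lemma ler_Rintegral_sin_sqrB (m : {measure set R -> \bar R}) (u e : R) (g h : R -> R) M :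
  m.-integrable setT (EFin \o (fun x => sin (u * x) ^+ 2)) ->
  measurable_fun setT g -> (forall v, -1 <= v <= 1 -> `|g v| <= M) ->
  measurable_fun setT h -> (forall v, -1 <= v <= 1 -> `|h v - g v| <= e) ->
  `|\int[m]_x (sin (u * x) ^+ 2 * h (sin (u * x))) -
    \int[m]_x (sin (u * x) ^+ 2 * g (sin (u * x)))| <= e * \int[m]_x (sin (u * x) ^+ 2).
Proof.
move=> im mg gM mh hg.
have hM v : -1 <= v <= 1 -> `|h v| <= e + M.
  move=> v1; rewrite -[h v](subrK (g v)) (le_trans (ler_normD _ _))//.
  by rewrite lerD// ?gM// hg.
have ig := integrable_sin_sqrM im mg gM; have ih := integrable_sin_sqrM im mh hM.
rewrite -RintegralB// (le_trans (le_normr_Rintegral _ (integrable_subR ih ig)))//.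
rewrite -RintegralZl//; apply: le_Rintegral => //.
- exact: integrable_norm (integrable_subR ih ig).
- exact: integrable_scaleR.
- move=> x _; rewrite -mulrBr normrM ger0_norm ?sqr_ge0// mulrC ler_wpM2r ?sqr_ge0//.
  by rewrite hg// sin_geN1 sin_le1.
Qed.

(* Weierstrass approximation reduces the convergence of the measures
   [sin (u x) ^ 2 mu_t(dx) / t] to that of their moments in [sin (u x)]. *)
Lemma sin_sqr_lipschitz_cvg (g : R -> R) u : bounded_lipschitz g ->
  (\int[mu t]_x (sin (u * x) ^+ 2 * g (sin (u * x)))) / t @[t --> 0^'+] -->
  \int[nu]_x (sin (u * x) ^+ 2 * g (sin (u * x))) + u ^+ 2 * sigma2 * g 0.
Proof.
move=> [M [L [M0 L0 gM gL]]].
have mg := measurable_lipschitz gL.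
have [C C0 HC] := sin_sqr_bounded nuw muE u.
pose C' := \int[nu]_x (sin (u * x) ^+ 2).
have C'0 : 0 <= C' by apply: Rintegral_ge0 => x _; exact: sqr_ge0.
have us0 : 0 <= u ^+ 2 * sigma2 by rewrite mulr_ge0// sqr_ge0.
apply/cvgrPdist_le => e e0.
(* Half of [e] pays for the limit with [p]. The other half pays for replacing [g] by [p] three
   times: under [mu t], under [nu] and in the Gaussian term, with weights [C], [C'] and
   [u ^ 2 * sigma2]. *)
pose S := C + C' + u ^+ 2 * sigma2 + 1.
have S0 : 0 < S by rewrite ltr_wpDl// !addr_ge0// ltW.
pose eta := e / 2 / S.
have eta0 : 0 < eta by rewrite !divr_gt0.
have [p pg] := lipschitz_poly_approx L0 eta0 gL.
have mp : measurable_fun setT (fun v : R => p.[v]).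
  by apply: continuous_measurable_fun; exact: continuous_horner.
have etaS : eta * C + (eta * C' + u ^+ 2 * sigma2 * eta) <= e / 2.
  have : eta * S = e / 2 by rewrite /eta divfK// gt_eqF.
  by rewrite /S => ?; lra.
clearbody eta.
have pT := trigpoly_polysin p u.
have /cvgrPdist_le/(_ _ (divr_gt0 e0 (ltr0n R 2))) Hp := trigpoly_generator nuw muE pT.
have gM' v : -1 <= v <= 1 -> `|g v| <= M by [].
near=> t.
have t0 : 0 < t by near: t; exact: nbhs_right_gt.
have h1 : `|generator0 sigma2 drift nu (fun x => sin (u * x) ^+ 2 * p.[sin (u * x)]) 0 0 (2 * u ^+ 2 * p.[0])
   - (\int[mu t]_x (sin (u * x) ^+ 2 * p.[sin (u * x)])) / t| <= e / 2.
  near: t; apply: filterS Hp => t; by rewrite subr0.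
have := ler_Rintegral_sin_sqrB (integrable_sin_sqr_nu u) mg gM' mp pg.
have := ler_Rintegral_sin_sqrB (integrable_sinX (mu t) u 2) mg gM' mp pg.
have HCt : \int[mu t]_x (sin (u * x) ^+ 2) <= C * t by near: t.
move: h1; rewrite (_ : generator0 _ _ _ _ _ _ _ = \int[nu]_x (sin (u * x) ^+ 2 * p.[sin (u * x)]) + u ^+ 2 * sigma2 * p.[0]); last first.
  rewrite /generator0 mul0r add0r addrC; congr (_ + _); last by field.
  by congr fine; apply: eq_integral => x _; rewrite mul0r !subr0.
have /= := pg 0; rewrite oppr_le0 !ler01 => /(_ isT).
set I1 := \int[nu]_x _; set I2 := \int[nu]_x _; set J1 := \int[mu t]_x _; set J2 := \int[mu t]_x _.
move=> h0 h1 h2 h3.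
have h2' : `|J1 / t - J2 / t| <= eta * C.
  rewrite -mulrBl normrM [X in _ * X]gtr0_norm ?invr_gt0// ler_pdivrMr//.
  by rewrite (le_trans h2)// -mulrA ler_wpM2l// ltW.
have h0' : `|u ^+ 2 * sigma2 * p.[0] - u ^+ 2 * sigma2 * g 0| <= u ^+ 2 * sigma2 * eta.
  by rewrite -mulrBr normrM ger0_norm// ler_wpM2l.
have -> : I2 + u ^+ 2 * sigma2 * g 0 - J2 / t =
  - (I1 - I2) - (u ^+ 2 * sigma2 * p.[0] - u ^+ 2 * sigma2 * g 0) +
  (I1 + u ^+ 2 * sigma2 * p.[0] - J1 / t) + (J1 / t - J2 / t) by ring.
rewrite (le_trans (ler_normD _ _))// (le_trans (lerD (ler_normD _ _) (lexx _)))//.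
rewrite (le_trans (lerD (lerD (ler_normB _ _) (lexx _)) (lexx _)))// normrN.
have h3' : `|I1 - I2| <= eta * C' by exact: h3.
lra.
Unshelve. all: by end_near.
Qed.

Lemma ramp_cvg (u a b : R) : 0 < a < b ->
  (\int[mu t]_x ramp a b (sin (u * x))) / t @[t --> 0^'+] -->
  \int[nu]_x ramp a b (sin (u * x)).
Proof.
move=> /andP[a0 ab].
(* [g] is the ramp divided by [v ^ 2]. It vanishes at 0, which removes the Gaussian term from the
   limit. *)
pose g (v : R) := ramp a b v * ((Num.max v a)^-1 * (Num.max v a)^-1).
have gL : bounded_lipschitz g.
  apply: bounded_lipschitzM; first exact: bounded_lipschitz_ramp.
  by apply: bounded_lipschitzM; exact: bounded_lipschitz_inv.
have g0 : g 0 = 0 by rewrite /g ramp_eq0 ?mul0r// ltW.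
have gE v : v ^+ 2 * g v = ramp a b v.
  rewrite /g; have [va|av] := leP v a; first by rewrite ramp_eq0// mul0r mulr0.
  by field; rewrite gt_eqF// (lt_trans a0).
have := @sin_sqr_lipschitz_cvg g u gL; rewrite g0 mulr0 addr0.
rewrite (_ : \int[nu]_x (sin (u * x) ^+ 2 * g (sin (u * x))) = \int[nu]_x ramp a b (sin (u * x))); last first.
  by congr fine; apply: eq_integral => x _; rewrite gE.
rewrite (_ : (fun t => (\int[mu t]_x (sin (u * x) ^+ 2 * g (sin (u * x)))) / t) =
  (fun t => (\int[mu t]_x ramp a b (sin (u * x))) / t))//.
by apply/funext => t; congr (fine _ / _); apply: eq_integral => x _; rewrite gE.
Qed.

Lemma measurable_ramp_sin (u a b : R) : a < b ->
  measurable_fun setT (fun x => ramp a b (sin (u * x))).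
Proof.
move=> /bounded_lipschitz_ramp[M [L [_ _ _ /measurable_lipschitz mr]]].
by apply: measurableT_comp => //; exact: measurable_sinZ.
Qed.

Lemma integrable_ramp_nu (u a b : R) : 0 < a < b ->
  nu.-integrable setT (EFin \o (fun x => ramp a b (sin (u * x)))).
Proof.
move=> /andP[a0 ab].
apply: (@integrable_dominated _ nu _ _ (a ^- 2) _ _ (integrable_sin_sqr_nu u)).
  exact: measurable_ramp_sin.
move=> x; rewrite ger0_norm ?ramp_ge0//; set v := sin _.
have [va|av] := leP v a; first by rewrite ramp_eq0// mulr_ge0 ?sqr_ge0// invr_ge0 sqr_ge0.
rewrite (le_trans (ramp_le1 _ _ _))// mulrC ler_pdivlMr ?exprn_gt0// mul1r.
by rewrite lerXn2r ?nnegrE ?(ltW a0) ?(ltW av) ?(ltW (lt_trans a0 av)).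
Qed.

(** With [u = 1 / K], [sin (u x)] increases on [[-K, K]], so there a ramp in it lies between the
    indicators of [[y2, +oo[] and [[y1, +oo[]; farther out both measures are small by [tail_small].
    The two levels differ because [nu] may have atoms here. *)
Lemma tail_sandwich (y1 y2 e : R) : 0 < y1 < y2 -> 0 < e ->
  \forall t \near (0 : R)^'+,
    fine (mu t `[y2, +oo[%classic) <= t * (fine (nu `[y1, +oo[%classic) + e) /\
    t * (fine (nu `[y2, +oo[%classic) - e) <= fine (mu t `[y1, +oo[%classic).
Proof.
move=> /andP[y10 y12] e0.
have e30 : 0 < e / 3 by rewrite divr_gt0.
have [K0 K00 [nuK HK]] := tail_small sigma2_ge0 nuw muE e30.
pose K := Num.max K0 y2.
have y20 : 0 < y2 by exact: lt_trans y12.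
have Kgt0 : 0 < K by rewrite lt_max K00.
have KK0 : K0 <= K by rewrite le_max lexx.
have Ky2 : y2 <= K by rewrite le_max lexx orbT.
have mK0 := @measurable_norm_gt R K0.
pose u := K^-1; have u0 : 0 < u by rewrite invr_gt0.
have piK : (1 : R) <= pi / 2 by exact: pihalf_ge1.
have uK x : `|x| <= K -> u * x \in `[(- (pi / 2)), pi / 2].
  move=> xK; rewrite in_itv/= -ler_norml normrM gtr0_norm//.
  by rewrite (le_trans _ piK)// /u ler_pdivrMl// mulr1.
have sinlt x y : `|x| <= K -> `|y| <= K -> (sin (u * x) < sin (u * y)) = (x < y).
  by move=> xK yK; rewrite ltr_sin ?uK// ltr_pM2l.
have y2K : `|y2| <= K by rewrite gtr0_norm.
have y1K : `|y1| <= K by rewrite gtr0_norm// (le_trans (ltW y12)).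
have sab : 0 < sin (u * y1) < sin (u * y2).
  rewrite sinlt// y12 andbT; have := sinlt 0 y1; rewrite mulr0 sin0 normr0 => ->//.
  exact: ltW.
have /andP[sa sb] := sab.
pose F (x : R) := ramp (sin (u * y1)) (sin (u * y2)) (sin (u * x)).
have F_ge x : \1_(`[y2, +oo[%classic) x <= F x + \1_[set x | K0 < `|x|] x.
  rewrite indicE; case: (boolP (x \in `[y2, +oo[%classic)) => [/set_mem/=|_]; last first.
    by rewrite addr_ge0// ramp_ge0.
  rewrite in_itv/= andbT => y2x; rewrite indicE.
  case: (boolP (x \in _)) => [_|/negP xK]; first by rewrite lerDr ramp_ge0.
  have xK0 : `|x| <= K by rewrite (le_trans _ KK0)// leNgt; apply/negP => h; apply: xK; rewrite inE.
  by rewrite addr0 /F ramp_eq1// leNgt sinlt// -leNgt.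
have F_le x : F x <= \1_(`[y1, +oo[%classic) x + \1_[set x | K0 < `|x|] x.
  rewrite !indicE; case: (boolP (x \in [set x | K0 < _])) => [_|/negP xK].
    by rewrite (le_trans (ramp_le1 _ _ _))// lerDr.
  have xK0 : `|x| <= K by rewrite (le_trans _ KK0)// leNgt; apply/negP => h; apply: xK; rewrite inE.
  rewrite addr0; case: (boolP (x \in _)) => [_|/negP xy1]; first exact: ramp_le1.
  rewrite /F ramp_eq0// leNgt sinlt//; apply/negP => h; apply: xy1; rewrite inE/= in_itv/= andbT.
  exact: ltW.
have iFn : nu.-integrable setT (EFin \o F) by exact: integrable_ramp_nu.
have iFm t : (mu t).-integrable setT (EFin \o F).
  apply: (@bounded_integrable _ _ _ _ _ 1); first exact: measurable_ramp_sin.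
  by move=> x; rewrite ger0_norm ?ramp_ge0// ramp_le1.
have inK : nu.-integrable setT (EFin \o (\1_[set x : R | K0 < `|x|])).
  by apply: (integrable_indic_away nuw K00) => // x /ltW.
have in_ y : 0 < y -> nu.-integrable setT (EFin \o (\1_(`[y, +oo[%classic : set R))).
  move=> y0; apply: (integrable_indic_away nuw y0) => // x /=.
  by rewrite in_itv/= andbT => /le_trans; apply; exact: ler_norm.
have nuE A : measurable A -> fine (nu A) = \int[nu]_x \1_A x.
  by move=> mA; rewrite /Rintegral integral_indic// setIT.
have FnL : fine (nu `[y2, +oo[%classic) <= \int[nu]_x F x + e / 3.
  rewrite (le_trans _ (lerD (lexx _) nuK))// !nuE// -RintegralD//.
  by apply: le_Rintegral => //; [exact: in_|exact: integrable_addR].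
have FnU : \int[nu]_x F x <= fine (nu `[y1, +oo[%classic) + e / 3.
  rewrite (le_trans _ (lerD (lexx _) nuK))// !nuE// -RintegralD//; last exact: in_.
  by apply: le_Rintegral => //; apply: integrable_addR => //; exact: in_.
have /cvgrPdist_le/(_ _ e30) HF := @ramp_cvg u _ _ sab.
near=> t.
have t0 : 0 < t by near: t; exact: nbhs_right_gt.
have mKt : fine (mu t [set x | K0 < `|x|]) <= t * (e / 3).
  by rewrite mulrC; near: t.
have FmU : \int[mu t]_x F x <= fine (mu t `[y1, +oo[%classic) + t * (e / 3).
  rewrite (le_trans _ (lerD (lexx _) mKt))// -!Rintegral_indic// -RintegralD//; try exact: integrable_indicR.
  apply: le_Rintegral => //; [exact: iFm|].
  by apply: integrable_addR; exact: integrable_indicR.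
have FmL : fine (mu t `[y2, +oo[%classic) <= \int[mu t]_x F x + t * (e / 3).
  rewrite (le_trans _ (lerD (lexx _) mKt))// -!Rintegral_indic// -RintegralD//; try exact: integrable_indicR; last exact: iFm.
  apply: le_Rintegral => //; first exact: integrable_indicR.
  by apply: integrable_addR; [exact: iFm|exact: integrable_indicR].
have : `|\int[nu]_x F x - (\int[mu t]_x F x) / t| <= e / 3 by near: t.
move: FnL FnU FmU FmL; set I := \int[nu]_x F x; set J := \int[mu t]_x F x.
move=> FnL FnU FmU FmL /ler_normlP[h1 h2].
have h1' : J <= t * (I + e / 3).
  by rewrite mulrC -ler_pdivrMr//; lra.
have h2' : t * (I - e / 3) <= J.
  by rewrite mulrC -ler_pdivlMr//; lra.
split.
  rewrite (le_trans FmL)// (le_trans (lerD h1' (lexx _)))// -mulrDr ler_pM2l//; lra.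
have : t * (fine (nu `[y2, +oo[%classic) - e / 3) <= t * I by rewrite ler_pM2l//; lra.
lra.
Unshelve. all: by end_near.
Qed.

End tail_limit.

(** * Decomposition at a big jump *)

Section translation_average.
Context {R : realType}.
Variable m : probability R R.
Implicit Types (w : R -> R) (f g : R -> \bar R).
Local Open Scope ereal_scope.

Definition nnmeasurable f := measurable_fun setT f /\ forall x, 0 <= f x.

Definition nnweight w := measurable_fun setT w /\ forall x, (0 <= w x)%R.

(** Positive operators on extended nonnegative functions, so that Tonelli applies with no
    integrability condition. The weight selects which steps are kept. *)
Definition average w f (x : R) := \int[m]_z ((w z)%:E * f (x + z)%R).

Lemma measurable_average2 w f : nnweight w -> nnmeasurable f ->
  measurable_fun setT (fun z : R * R => (w z.2)%:E * f (z.1 + z.2)%R).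
Proof.
move=> [mw _] [mf _]; apply: emeasurable_funM.
  by apply/measurable_EFinP; apply: measurableT_comp => //; exact: measurable_snd.
apply: measurableT_comp => //.
by apply: measurable_funD; [exact: measurable_fst|exact: measurable_snd].
Qed.

Lemma nnmeasurable_average w f : nnweight w -> nnmeasurable f -> nnmeasurable (average w f).
Proof.
move=> nw nf; have [[mw w0] [mf f0]] := (nw, nf); split.
  apply: (@measurable_fun_fubini_tonelli_F _ _ _ _ _ m
    (fun z : R * R => (w z.2)%:E * f (z.1 + z.2)%R)).
    exact: measurable_average2.
  by move=> z; rewrite mule_ge0// lee_fin.
by move=> x; apply: integral_ge0 => z _; rewrite mule_ge0// lee_fin.
Qed.

Lemma measurable_average1 w f x : nnweight w -> nnmeasurable f ->
  measurable_fun setT (fun z => (w z)%:E * f (x + z)%R).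
Proof.
move=> [mw _] [mf _]; apply: emeasurable_funM; first exact/measurable_EFinP.
by apply: measurableT_comp => //; exact: measurable_funD.
Qed.

Lemma le_average w1 w2 f g x : nnweight w1 -> nnweight w2 -> nnmeasurable f -> nnmeasurable g ->
  (forall z, (w1 z <= w2 z)%R) -> (forall z, f z <= g z) -> average w1 f x <= average w2 g x.
Proof.
move=> n1 n2 nf ng w12 fg; have [[mw1 w10] [mw2 w20] [mf f0] [mg g0]] := And4 n1 n2 nf ng.
apply: ge0_le_integral => //.
- by move=> z _; rewrite mule_ge0// lee_fin.
- exact: measurable_average1.
- exact: measurable_average1.
- by move=> z _; rewrite lee_pmul// lee_fin.
Qed.

Lemma averageD w f g x : nnweight w -> nnmeasurable f -> nnmeasurable g ->
  average w (fun z => f z + g z) x = average w f x + average w g x.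
Proof.
move=> nw nf ng; have [[mw w0] [mf f0] [mg g0]] := And3 nw nf ng.
rewrite /average -ge0_integralD//; last 4 first.
- by move=> z _; rewrite mule_ge0// lee_fin.
- exact: measurable_average1.
- by move=> z _; rewrite mule_ge0// lee_fin.
- exact: measurable_average1.
by apply: eq_integral => z _; rewrite ge0_muleDr.
Qed.

Lemma average_weightD w1 w2 f x : nnweight w1 -> nnweight w2 -> nnmeasurable f ->
  average (fun z => (w1 z + w2 z)%R) f x = average w1 f x + average w2 f x.
Proof.
move=> n1 n2 nf; have [[mw1 w10] [mw2 w20] [mf f0]] := And3 n1 n2 nf.
rewrite /average -ge0_integralD//; last 4 first.
- by move=> z _; rewrite mule_ge0// lee_fin.
- exact: measurable_average1.
- by move=> z _; rewrite mule_ge0// lee_fin.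
- exact: measurable_average1.
by apply: eq_integral => z _; rewrite EFinD ge0_muleDl// lee_fin.
Qed.

Lemma averageZ w f (k : R) x : (0 <= k)%R -> nnweight w -> nnmeasurable f ->
  average w (fun z => k%:E * f z) x = k%:E * average w f x.
Proof.
move=> k0 nw nf; have [[mw w0] [mf f0]] := (nw, nf).
rewrite /average -ge0_integralZl//; last 2 first.
- exact: measurable_average1.
- by move=> z _; rewrite mule_ge0// lee_fin.
by apply: eq_integral => z _; rewrite muleCA.
Qed.

(** Translation invariant operators commute, by Tonelli. In terms of paths, the steps are
    exchangeable, so a big step can be moved to any position. *)
Lemma averageC w1 w2 f x : nnweight w1 -> nnweight w2 -> nnmeasurable f ->
  average w1 (average w2 f) x = average w2 (average w1 f) x.
Proof.
move=> n1 n2 nf; have [[mw1 w10] [mw2 w20] [mf f0]] := And3 n1 n2 nf.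
pose F (p : R * R) := (w1 p.1)%:E * ((w2 p.2)%:E * f (x + p.1 + p.2)%R).
have mF : measurable_fun setT F.
  apply: emeasurable_funM.
    by apply/measurable_EFinP; apply: measurableT_comp => //; exact: measurable_fst.
  apply: emeasurable_funM.
    by apply/measurable_EFinP; apply: measurableT_comp => //; exact: measurable_snd.
  apply: measurableT_comp => //; apply: measurable_funD; last exact: measurable_snd.
  by apply: measurable_funD => //; exact: measurable_fst.
have F0 p : 0 <= F p by rewrite mule_ge0 ?lee_fin// mule_ge0// lee_fin.
transitivity (\int[m]_y \int[m]_z F (y, z)).
  apply: eq_integral => y _; rewrite /F /= ge0_integralZl//.
  - exact: measurable_average1.
  - by move=> z _; rewrite mule_ge0// lee_fin.
  - by rewrite lee_fin.
rewrite (@fubini_tonelli _ _ _ _ _ m m F mF F0); apply: eq_integral => z _.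
rewrite /average -ge0_integralZl//.
- by apply: eq_integral => y _; rewrite /F /= muleCA addrAC.
- exact: measurable_average1.
- by move=> y _; rewrite mule_ge0// lee_fin.
- by rewrite lee_fin.
Qed.

Lemma nnmeasurable_iter w f n : nnweight w -> nnmeasurable f ->
  nnmeasurable (iter n (average w) f).
Proof. by move=> nw nf; elim: n => //= n IH; exact: nnmeasurable_average. Qed.

Lemma averageC_iter w1 w2 f n : nnweight w1 -> nnweight w2 -> nnmeasurable f ->
  average w2 (iter n (average w1) f) =1 iter n (average w1) (average w2 f).
Proof.
move=> n1 n2 nf; elim: n => [//|n IH] x /=.
rewrite averageC//; last exact: nnmeasurable_iter.
by congr (average w1 _ _); exact/funext.
Qed.

Lemma nnweight1 : nnweight (cst 1%R).
Proof. by split. Qed.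

Lemma nnweight_indic (A : set R) : measurable A -> nnweight \1_A.
Proof. by move=> mA; split => // x; rewrite indicE. Qed.

Lemma average1_le f (c : R) x : nnmeasurable f -> (forall z, f z <= c%:E) ->
  average (cst 1%R) f x <= c%:E.
Proof.
move=> nf fc; rewrite (@le_trans _ _ (\int[m]_z c%:E))//.
  apply: ge0_le_integral => //.
  - by move=> z _; rewrite mul1e; case: nf.
  - exact: measurable_average1.
  - by move=> z _; rewrite mul1e.
by rewrite integral_cst// [X in _ * X](probability_setT m) mule1.
Qed.

(* [T] averages over one step of law [m]; [A] and [B] keep only the steps outside,
   respectively inside, [J]. *)
Section jumps.
Variable J : set R.
Hypothesis mJ : measurable J.
Let T := average (cst 1%R).
Let A := average \1_(~` J).
Let B := average \1_J.

Let nT := nnweight1.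
Let nA := nnweight_indic (measurableC mJ).
Let nB := nnweight_indic mJ.

Lemma average_split f : nnmeasurable f -> T f =1 (fun x => A f x + B f x).
Proof.
move=> nf x; rewrite -average_weightD//; congr (average _ _ _).
apply/funext => z; rewrite !indicE in_setC.
by case: (z \in J); rewrite ?addr0 ?add0r.
Qed.

Lemma le_average_small f x : nnmeasurable f -> A f x <= T f x.
Proof.
by move=> nf; apply: le_average => // z; rewrite indicE; case: (_ \in _).
Qed.

(** Since [T = A + B], the difference [T^n - A^n] is the sum of the [A^i B T^(n-1-i)]. Commuting [B]
    inwards and using [A <= T] bounds each of these [n] terms by [T^(n-1) B]. At [n = 0] the factor
    [n] hides the value of [n.-1]. *)
Lemma first_jump_le f n x : nnmeasurable f ->
  iter n T f x <= iter n A f x + n%:R%:E * iter n.-1 T (B f) x.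
Proof.
move=> nf; have nTi k g : nnmeasurable g -> nnmeasurable (iter k T g) by exact: nnmeasurable_iter.
have nAi k g : nnmeasurable g -> nnmeasurable (iter k A g) by exact: nnmeasurable_iter.
have nBf : nnmeasurable (B f) by exact: nnmeasurable_average.
elim: n x => [|n IH] x; first by rewrite mul0e adde0.
rewrite [leLHS]average_split; last exact: nTi.
have nG : nnmeasurable (fun z => n%:R%:E * iter n.-1 T (B f) z).
  have [h1 h2] := nTi n.-1 _ nBf; split.
    by apply: emeasurable_funM => //; exact: measurable_cst.
  by move=> z; rewrite mule_ge0// lee_fin.
have nS : nnmeasurable (fun z => iter n A f z + n%:R%:E * iter n.-1 T (B f) z).
  have [h1 h2] := nAi n f nf; have [h3 h4] := nG; split.
    exact: emeasurable_funD.
  by move=> z; rewrite adde_ge0.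
have h1 : A (iter n T f) x <= A (fun z => iter n A f z + n%:R%:E * iter n.-1 T (B f) z) x.
  by apply: le_average => //; exact: nTi.
have h2 : A (fun z => n%:R%:E * iter n.-1 T (B f) z) x <= n%:R%:E * iter n T (B f) x.
  rewrite /A averageZ//; last exact: nTi.
  case: n {IH nG nS h1} => [|n]; first by rewrite !mul0e.
  by rewrite lee_pmul2l//= ?lte_fin ?ltr0n//; apply: le_average_small; exact: nTi.
have -> : B (iter n T f) x = iter n T (B f) x by exact: averageC_iter.
rewrite (le_trans (leeD h1 (lexx _)))//.
rewrite [X in X + _]averageD//; last exact: nAi.
rewrite -addeA leeD2l//= (le_trans (leeD h2 (lexx _)))//.
rewrite -[in leRHS](natr1 n) EFinD ge0_muleDl ?lee_fin// mul1e//.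
Qed.

(* The correction [(n * b) ^ 2] pays for the paths with at least two steps in [J]. *)
Lemma le_first_jump f (b : R) n x : nnmeasurable f -> (forall z, f z <= 1) ->
  m J <= b%:E -> (0 <= b)%R ->
  n%:R%:E * iter n.-1 T (B f) x <= iter n T f x + ((n%:R * b) ^+ 2)%:E.
Proof.
move=> nf f1 Jb b0; have nTi k g : nnmeasurable g -> nnmeasurable (iter k T g) by exact: nnmeasurable_iter.
have nBf : nnmeasurable (B f) by exact: nnmeasurable_average.
have Bc (g : R -> \bar R) (c : R) z : nnmeasurable g -> (0 <= c)%R -> (forall y, g y <= c%:E) ->
    B g z <= (c * b)%:E.
  move=> ng c0 gc; rewrite (@le_trans _ _ (\int[m]_y (c%:E * (\1_J y)%:E)))//.
    apply: ge0_le_integral => //.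
    - by move=> y _; rewrite mule_ge0//; case: ng.
    - exact: measurable_average1.
    - by apply: emeasurable_funM => //; apply/measurable_EFinP; exact: measurable_indic.
    - by move=> y _; rewrite muleC lee_pmul// ?lee_fin ?indicE//; case: ng.
  rewrite ge0_integralZl//.
    by rewrite integral_indic// setIT EFinM lee_pmul.
  by apply/measurable_EFinP; exact: measurable_indic.
have TB k z : iter k T (B f) z <= b%:E.
  elim: k z => [z|k IH z /=]; first by have := Bc f 1%R z nf ler01 f1; rewrite mul1r.
  by apply: average1_le => //; exact: nTi.
elim: n x => [|n IH] x; first by rewrite mul0e mul0r expr0n adde0; case: nf.
rewrite -[in leLHS](natr1 n) EFinD ge0_muleDl ?lee_fin// mul1e/=.
have nG : nnmeasurable (fun z => n%:R%:E * iter n.-1 T (B f) z).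
  have [h1 h2] := nTi n.-1 _ nBf; split.
    by apply: emeasurable_funM => //; exact: measurable_cst.
  by move=> z; rewrite mule_ge0// lee_fin.
have nc (c : R) : (0 <= c)%R -> nnmeasurable (cst c%:E) by move=> c0; split=> // ?; rewrite lee_fin.
have nb0 : (0 <= (n%:R * b) ^+ 2)%R by exact: sqr_ge0.
have nS : nnmeasurable (fun z => iter n T f z + ((n%:R * b) ^+ 2)%:E).
  have [h1 h2] := nTi n f nf; split; first by apply: emeasurable_funD.
  by move=> z; rewrite adde_ge0// lee_fin.
(* Expand one [T] in [n T^n B f]. After a step outside [J] the induction hypothesis applies; a step
   inside [J] comes on top of the one in [B f] and costs at most [n * b * b]. *)
have h1 : n%:R%:E * iter n T (B f) x <= A (iter n T f) x + ((n%:R * b) ^+ 2 + n%:R * b * b)%:E.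
  case: n IH nG nS nb0 => [|n] IH nG nS nb0.
    by rewrite mul0e mul0r expr0n mul0r addr0 adde0; case: (nnmeasurable_average nA nf).
  rewrite /= -averageZ ?ler0n//; last exact: nTi.
  rewrite -[leLHS]/(T _ x) average_split// EFinD [leRHS]addeA leeD//; last first.
    apply: Bc => //; first by rewrite mulr_ge0.
    by move=> y; rewrite EFinM lee_pmul2l// ?lte_fin ?ltr0n//; exact: TB.
  rewrite (@le_trans _ _ (A (fun z => iter n.+1 T f z + ((n.+1%:R * b) ^+ 2)%:E) x))//.
    by apply: le_average.
  rewrite [leLHS]averageD//; last exact: (nTi n.+1).
  rewrite leeD2l// (@le_trans _ _ (T (cst ((n.+1%:R * b) ^+ 2)%:E) x))//.
    by apply: le_average_small; exact: nc.
  by apply: average1_le => //; exact: nc.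
(* The remaining [T^n B f] equals [B T^n f] and completes [A T^n f] to [T^(n+1) f]; then
   [(n b) ^ 2 + n b ^ 2 <= ((n + 1) b) ^ 2]. *)
rewrite (le_trans (leeD h1 (lexx _)))// -(averageC_iter _ nT nB nf).
rewrite average_split; last exact: nTi.
rewrite -addeA -[leRHS]addeA leeD2l// addeC leeD2l// lee_fin.
rewrite -(natr1 n) !exprMn.
have : (0 <= n%:R * b ^+ 2)%R by rewrite mulr_ge0// sqr_ge0.
have : (0 <= b ^+ 2)%R by exact: sqr_ge0.
lra.
Qed.

(** Exponentials are eigenfunctions of translation invariant operators: each application of [A]
    multiplies [expR (k + c * x)] by the exponential moment of a small step, at most [q]. *)
Lemma iter_average_expR f (c k q : R) n x : nnmeasurable f ->
  (forall z, f z <= (expR (k + c * z))%:E) ->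
  \int[m]_z (\1_(~` J) z * expR (c * z))%:E <= q%:E ->
  iter n A f x <= (q ^+ n * expR (k + c * x))%:E.
Proof.
move=> nf fe eq.
have me : measurable_fun setT (fun z => expR (c * z)).
  by apply: measurableT_comp; [exact: measurable_expR|exact: mulrl_measurable].
have q0 : (0 <= q)%R.
  rewrite -lee_fin (le_trans _ eq)//; apply: integral_ge0 => z _.
  by rewrite lee_fin mulr_ge0// ?indicE// expR_ge0.
elim: n x => [x|n IH x]; first by rewrite expr0 mul1r; exact: fe.
rewrite /= (@le_trans _ _ (A (fun z => (q ^+ n * expR (k + c * z))%:E) x))//.
  apply: le_average => //; first exact: nnmeasurable_iter.
  split; first by apply/measurable_EFinP; apply: measurable_funM => //; apply: measurableT_comp; [exact: measurable_expR|exact: measurable_funD].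
  by move=> z; rewrite lee_fin mulr_ge0 ?expR_ge0// exprn_ge0.
rewrite [leLHS](_ : _ = \int[m]_z ((q ^+ n * expR (k + c * x))%:E * (\1_(~` J) z * expR (c * z))%:E)); last first.
  apply: eq_integral => z _; rewrite -!EFinM; congr (_%:E).
  have -> : (k + c * (x + z) = (k + c * x) + c * z)%R by ring.
  by rewrite expRD; ring.
have qn0 : (0 <= q ^+ n * expR (k + c * x))%R by rewrite mulr_ge0 ?expR_ge0// exprn_ge0.
rewrite ge0_integralZl//.
- have -> : (q ^+ n.+1 * expR (k + c * x) = q ^+ n * expR (k + c * x) * q)%R by rewrite exprSr; ring.
  rewrite [leRHS]EFinM lee_pmul// ?lee_fin//; apply: integral_ge0 => z _.
  by rewrite lee_fin mulr_ge0 ?expR_ge0// indicE.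
- by apply/measurable_EFinP; apply: measurable_funM => //; exact: measurable_indic (measurableC mJ).
Qed.

End jumps.
End translation_average.

(** * Second order expansion of the tail of a convolution semigroup *)

Section convolution_semigroup.
Context {R : realType}.

Definition convolution_semigroup (mu : R -> probability R R) : Prop :=
  forall s h : R, 0 <= s -> 0 <= h -> forall f : R -> \bar R, nnmeasurable f ->
    (\int[mu (s + h)%R]_x f x = \int[mu s]_x \int[mu h]_z f (x + z)%R)%E.

(** Starting at one step avoids identifying [mu 0] with the point mass at 0. *)
Lemma iter_average_semigroup (mu : R -> probability R R) (h : R) n (f : R -> \bar R) :
  convolution_semigroup mu -> 0 <= h -> nnmeasurable f ->
  iter n.+1 (average (mu h) (cst 1)) f 0 = (\int[mu (n.+1%:R * h)%R]_x f x)%E.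
Proof.
move=> muC h0; elim: n f => [|n IH] f nf.
  by rewrite mul1r /average/=; apply: eq_integral => z _; rewrite mul1e add0r.
rewrite iterSr IH; last by apply: nnmeasurable_average => //; exact: nnweight1.
rewrite -[in RHS](natr1 n.+1) mulrDl mul1r muC// ?mulr_ge0//.
by apply: eq_integral => x _; apply: eq_integral => z _; rewrite mul1e.
Qed.

End convolution_semigroup.

Section exponential_moment.
Context {R : realType}.
Variables (m : probability R R) (e : R).
Hypothesis e01 : 0 < e <= 1.
Let J := [set x : R | e < `|x|].

Lemma indic_smallE x : \1_(~` J) x = \1_[set x : R | `|x| <= e] x :> R.
Proof.
by rewrite !indicE; congr (_ _)%:R; congr (_ \in _); apply/seteqP; split => y /=; rewrite leNgt => /negP.
Qed.

(** Integrate [expR (c x) <= 1 + c x + c ^ 2 x ^ 2 expR (c e)] over [|x| <= e] and use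
    [1 + z <= expR z]. The resulting exponent is proportional to [h], so that the [n]-th power will
    depend on [n] and [h] through [n h] only. *)
Lemma exponential_moment_small (c C h : R) : 0 <= c -> 0 <= h -> 0 <= C ->
  \int[m]_x (x ^+ 2 * \1_[set x | `|x| <= e] x) <= C * h ->
  `|\int[m]_x (x * \1_[set x | `|x| <= e] x)| <= C * h ->
  (\int[m]_z (\1_(~` J) z * expR (c * z))%:E <=
   (expR (h * (C * (e^-1 + 4 * e ^- 2)) * expR (2 * (c * e))))%:E)%E.
Proof.
move=> c0 h0 C0 m2 m1; have /andP[e0 e1] := e01.
have me := measurable_norm_le e.
set E := expR (c * e); have E1 : 1 <= E by rewrite -expR0 ler_expR mulr_ge0// ltW.
have E0 : 0 < E by exact: expR_gt0.
set S := [set x | _] in m2 m1 me *.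
have bS (f : R -> R) : measurable_fun setT f -> (forall x, `|x| <= e -> `|f x| <= E + 1) ->
    m.-integrable setT (EFin \o (fun x => f x * \1_S x)).
  move=> mf fb; apply: (@bounded_integrable _ _ _ _ _ (E + 1)).
    by apply: measurable_funM => //; exact: measurable_indic.
  move=> x; rewrite indicE; case: (boolP (x \in S)) => [/set_mem xS|_].
    by rewrite mulr1 fb.
  by rewrite mulr0 normr0 addr_ge0// ltW.
have iX : m.-integrable setT (EFin \o (fun x => x * \1_S x)).
  apply: (bS id) => // x xe; rewrite (le_trans xe)// (le_trans e1)// lerDr ltW//.
have iX2 : m.-integrable setT (EFin \o (fun x => x ^+ 2 * \1_S x)).
  apply: (bS (fun x => x ^+ 2)); first exact: measurable_funX.
  move=> x xe; rewrite normrX (@le_trans _ _ 1)//; last by rewrite lerDr ltW.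
  by rewrite expr_le1// (le_trans xe).
have i1 : m.-integrable setT (EFin \o \1_S) by exact: integrable_indicR.
have iexp : m.-integrable setT (EFin \o (fun x => expR (c * x) * \1_S x)).
  apply: bS; first by apply: measurableT_comp; [exact: measurable_expR|exact: mulrl_measurable].
  move=> x xe; rewrite ger0_norm ?expR_ge0// (@le_trans _ _ E)//; last by rewrite lerDl.
  by rewrite ler_expR ler_wpM2l// (le_trans (ler_norm _)).
rewrite (_ : (\int[m]_z _)%E = (\int[m]_x (expR (c * x) * \1_S x))%:E); last first.
  rewrite fineK; last exact: integrable_fin_num iexp.
  by apply: eq_integral => x _; rewrite indic_smallE mulrC.
rewrite lee_fin.
apply: (@le_trans _ _ (\int[m]_x (\1_S x + c * (x * \1_S x) + c ^+ 2 * E * (x ^+ 2 * \1_S x)))).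
  apply: le_Rintegral => //.
    by apply: integrable_addR; [apply: integrable_addR => //; exact: integrable_scaleR|exact: integrable_scaleR].
  move=> x _; rewrite indicE; case: (boolP (x \in S)) => [/set_mem xS|_]; last by rewrite !mulr0 !addr0.
  rewrite !mulr1 (le_trans (expR_le_quadratic _))// lerD// exprMn mulrAC.
  rewrite ler_wpM2r ?sqr_ge0// ler_wpM2l ?sqr_ge0//.
  by rewrite ler_expR normrM (ger0_norm c0) ler_wpM2l.
rewrite RintegralD//; [|by apply: integrable_addR => //; exact: integrable_scaleR|exact: integrable_scaleR].
rewrite RintegralD//; last exact: integrable_scaleR.
rewrite !RintegralZl// Rintegral_indic//.
apply: le_trans (expR_ge1Dx _); rewrite -addrA lerD//.
  by rewrite -lee_fin fineK ?fin_num_measure// probability_le1.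
have h1 : c * \int[m]_x (x * \1_S x) <= c * (C * h).
  by rewrite ler_wpM2l// (le_trans (ler_norm _)).
have h2 : c ^+ 2 * E * \int[m]_x (x ^+ 2 * \1_S x) <= c ^+ 2 * E * (C * h).
  by rewrite ler_wpM2l// mulr_ge0 ?sqr_ge0// ltW.
rewrite (le_trans (lerD h1 h2))//.
(* [c] and [c ^ 2] are absorbed through [c e <= expR (c e)] and [(c e / 2) ^ 2 <= expR (c e)],
   whence the constants [e^-1] and [4 * e ^- 2]. *)
have ceE : c <= E * e^-1.
  by rewrite ler_pdivlMr// (le_trans _ (expR_ge1Dx _))// lerDr.
have c2E : c ^+ 2 <= 4 * e ^- 2 * E.
  rewrite -[E](_ : expR (c * e / 2) ^+ 2 = _); last first.
    by rewrite -expRM_natl; congr expR; field.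
  rewrite mulrAC ler_pdivlMr ?exprn_gt0//.
  have : c * e / 2 <= expR (c * e / 2) by rewrite (le_trans _ (expR_ge1Dx _))// lerDr.
  have : 0 <= c * e / 2 by rewrite !mulr_ge0// ltW.
  set X := expR _; move=> p0 pX; have : (c * e / 2) ^+ 2 <= X ^+ 2 by rewrite lerXn2r ?nnegrE// (le_trans p0).
  by move=> ?; rewrite -exprMn; lra.
have -> : expR (2 * (c * e)) = E * E by rewrite /E -expRD; congr expR; ring.
have Ch0 : 0 <= C * h by rewrite mulr_ge0.
have s1 : c * (C * h) <= E * E * e^-1 * (C * h).
  by rewrite ler_wpM2r// (le_trans ceE)// ler_wpM2r ?invr_ge0 ?(ltW e0)// ler_peMl// (ltW E0).
have s2 : c ^+ 2 * E * (C * h) <= 4 * e ^- 2 * E * E * (C * h).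
  by rewrite ler_wpM2r// ler_wpM2r// ltW.
lra.
Qed.

End exponential_moment.

Section uniform.
Context {R : realType}.
Variables (sigma2 drift : R) (nu : {measure set R -> \bar R}).
Hypothesis sigma2_ge0 : 0 <= sigma2.
Hypothesis nuw : (\int[nu]_x (levy_weight x)%:E < +oo)%E.
Variable mu : R -> probability R R.
Hypothesis muE : has_exponent sigma2 drift nu mu.
Let G (z : R) := fine (nu `[z, +oo[%classic).

Lemma tail_uniform (lo hi M d e : R) : 0 < lo -> 0 <= M -> 0 < d -> 0 < e ->
  (forall z1 z2, lo <= z1 -> z1 <= z2 -> z2 <= hi -> G z1 <= G z2 + M * (z2 - z1)) ->
  \forall h \near (0 : R)^'+, forall z, lo + d <= z <= hi - d ->
    `|fine (mu h `[z, +oo[%classic) - h * G z| <= h * e.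
Proof.
move=> lo0 M0 d0 e0 GM.
(* The margin [d] leaves room for two cells on each side of [z], and [G] varies by at most [e / 2]
   over a length of two cells. *)
pose del := Num.min (d / 2) (e / (4 * (M + 1))).
have M1 : 0 < 4 * (M + 1) by rewrite mulr_gt0// ltr_wpDl.
have del0 : 0 < del by rewrite lt_min !divr_gt0.
have deld : 2 * del <= d.
  have : del <= d / 2 by rewrite ge_min lexx.
  lra.
have delM : 2 * del * M <= e / 2.
  have : del <= e / (4 * (M + 1)) by rewrite ge_min lexx orbT.
  by rewrite ler_pdivlMr// => ?; lra.
pose N := (Num.truncn ((hi - lo) / del)).+1.
have e2 : 0 < e / 2 by rewrite divr_gt0.
have HN : forall i : 'I_N, \forall h \near (0 : R)^'+,
    fine (mu h `[lo + i.+1%:R * del, +oo[%classic) <= h * (G (lo + i%:R * del) + e / 2) /\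
    h * (G (lo + i.+1%:R * del) - e / 2) <= fine (mu h `[lo + i%:R * del, +oo[%classic).
  move=> i; apply: (tail_sandwich sigma2_ge0 nuw muE) => //.
  by rewrite ltr_pwDl ?mulr_ge0 ?(ltW del0)//= ltrD2l ltr_pM2r// ltr_nat.
have mono h (y z : R) : y <= z -> fine (mu h `[z, +oo[%classic) <= fine (mu h `[y, +oo[%classic).
  move=> yz; rewrite fine_le ?fin_num_measure// le_measure ?inE//.
  by apply: subitvPl; rewrite bnd_simp.
have /filter_forall HF := HN.
near=> h; have h0 : 0 < h by near: h; exact: nbhs_right_gt.
have HFh : forall i : 'I_N, fine (mu h `[lo + i.+1%:R * del, +oo[%classic) <= h * (G (lo + i%:R * del) + e / 2) /\
    h * (G (lo + i.+1%:R * del) - e / 2) <= fine (mu h `[lo + i%:R * del, +oo[%classic).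
  by near: h; exact: HF.
move=> z /andP[zlo zhi].
have zl0 : 0 <= (z - lo) / del by rewrite divr_ge0 ?(ltW del0)//; lra.
have /andP[i1 i2] := truncn_itv zl0.
set i := Num.truncn _ in i1 i2.
have {}i1 : i%:R * del <= z - lo by rewrite -ler_pdivlMr.
have {}i2 : z - lo < i.+1%:R * del by rewrite -ltr_pdivrMr.
have iS : i.+1%:R * del = i%:R * del + del by rewrite -natr1 mulrDl mul1r.
have iSS : i.+2%:R * del = i%:R * del + 2 * del by rewrite -!natr1; ring.
(* Since [z - lo >= 2 * del], [z] is not in the first cell, so there is a grid point [y0] below its
   cell. *)
case: i => [|i] in i1 i2 iS iSS *; first lra.
have iN : (i.+2 < N)%N.
  rewrite ltnS truncn_ge_nat; last by rewrite divr_ge0 ?(ltW del0)//; lra.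
  by rewrite ler_pdivlMr//; lra.
have [hU _] := HFh (Ordinal (ltnW (ltnW iN))).
have [_ hL] := HFh (Ordinal iN).
have i3 : i.+3%:R * del = i.+1%:R * del + 2 * del by rewrite -!natr1; ring.
have i0 : i.+1%:R * del = i%:R * del + del by rewrite -natr1; ring.
have i00 : 0 <= i%:R * del by rewrite mulr_ge0// ltW.
move: hU hL => /=; set y0 := lo + i%:R * del; set y1 := lo + i.+1%:R * del.
set y2 := lo + i.+2%:R * del; set y3 := lo + i.+3%:R * del => hU hL.
have m1 : fine (mu h `[z, +oo[%classic) <= fine (mu h `[y1, +oo[%classic).
  by apply: mono; rewrite /y1; lra.
have m2 : fine (mu h `[y2, +oo[%classic) <= fine (mu h `[z, +oo[%classic).
  by apply: mono; rewrite /y2; lra.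
have g1 : G y0 <= G z + e / 2.
  rewrite (le_trans (GM y0 z _ _ _))//; rewrite /y0; try lra.
  rewrite lerD2l (le_trans _ delM)// mulrC ler_wpM2r//; lra.
have g2 : G z <= G y3 + e / 2.
  rewrite (le_trans (GM z y3 _ _ _))//; rewrite /y3; try lra.
  rewrite lerD2l (le_trans _ delM)// mulrC ler_wpM2r//; lra.
have u1 : h * (G y0 + e / 2) <= h * (G z + e) by rewrite ler_pM2l//; lra.
have u2 : h * (G z - e) <= h * (G y3 - e / 2) by rewrite ler_pM2l//; lra.
by rewrite ler_norml; apply/andP; split; lra.
Unshelve. all: by end_near.
Qed.

(** One [C] for two radii: [e] will cut the single steps, [d] the sum of the remaining ones. *)
Lemma small_time_bounds (e d : R) : 0 < e <= 1 -> 0 < d <= 1 -> exists2 C, 0 < C &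
  \forall t \near (0 : R)^'+,
    ([/\ fine (mu t [set x | e < `|x|]%R) <= C * t,
         \int[mu t]_x (x ^+ 2 * \1_[set x | `|x| <= e] x) <= C * t &
         `|\int[mu t]_x (x * \1_[set x | `|x| <= e] x)| <= C * t] /\
     [/\ fine (mu t [set x | d < `|x|]%R) <= C * t,
         \int[mu t]_x (x ^+ 2 * \1_[set x | `|x| <= d] x) <= C * t &
         `|\int[mu t]_x (x * \1_[set x | `|x| <= d] x)| <= C * t]).
Proof.
have H r : 0 < r <= 1 -> exists2 C, 0 < C & \forall t \near (0 : R)^'+,
    [/\ fine (mu t [set x | r < `|x|]%R) <= C * t,
         \int[mu t]_x (x ^+ 2 * \1_[set x | `|x| <= r] x) <= C * t &
         `|\int[mu t]_x (x * \1_[set x | `|x| <= r] x)| <= C * t].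
  move=> r01; have /andP[r0 r1] := r01.
  have [C1 C10 H1] := jump_bound sigma2_ge0 nuw muE r0.
  have [C2 C20 H2] := second_moment_bound nuw muE r01.
  have [C3 C30 H3] := first_moment_bound sigma2_ge0 nuw muE r01.
  exists (C1 + C2 + C3); first by rewrite !addr_gt0.
  near=> t; have t0 : 0 < t by near: t; exact: nbhs_right_gt.
  have [p1 p2 p3] : [/\ 0 <= C1 * t, 0 <= C2 * t & 0 <= C3 * t] by rewrite !mulr_ge0// ltW.
  split.
  - by rewrite (@le_trans _ _ (C1 * t))//; [near: t|lra].
  - by rewrite (@le_trans _ _ (C2 * t))//; [near: t|lra].
  - by rewrite (@le_trans _ _ (C3 * t))//; [near: t|lra].
move=> /H[C C0 HC] /H[D D0 HD]; exists (C + D); first exact: addr_gt0.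
near=> t; have t0 : 0 < t by near: t; exact: nbhs_right_gt.
have [p1 p2] : 0 <= C * t /\ 0 <= D * t by rewrite !mulr_ge0// ltW.
have CDt : C * t <= (C + D) * t by lra.
have DCt : D * t <= (C + D) * t by lra.
have [h1 h2 h3] : [/\ fine (mu t [set x | e < `|x|]%R) <= C * t,
         \int[mu t]_x (x ^+ 2 * \1_[set x | `|x| <= e] x) <= C * t &
         `|\int[mu t]_x (x * \1_[set x | `|x| <= e] x)| <= C * t] by near: t.
have [h4 h5 h6] : [/\ fine (mu t [set x | d < `|x|]%R) <= D * t,
         \int[mu t]_x (x ^+ 2 * \1_[set x | `|x| <= d] x) <= D * t &
         `|\int[mu t]_x (x * \1_[set x | `|x| <= d] x)| <= D * t] by near: t.
split; split; [exact: le_trans CDt|exact: le_trans CDt|exact: le_trans CDt|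
  exact: le_trans DCt|exact: le_trans DCt|exact: le_trans DCt].
Unshelve. all: by end_near.
Qed.

End uniform.

Section one_step.
Context {R : realType}.
Variable m : probability R R.

(* Near 0, [phi] is affine up to [h * (L * x ^ 2 + u)], so only the mass of [m]
   away from 0 and its first two truncated moments enter the error. *)
Lemma integral_tail_expansion (phi : R -> R) (d h g q L C r u : R) :
  measurable_fun setT phi -> 0 < d <= 1 -> 0 <= h -> 0 <= L -> 0 <= u -> 0 <= g -> 0 <= C -> 0 <= r ->
  (forall x, 0 <= phi x <= C * h) ->
  (forall x, `|x| <= d -> `|phi x - h * (g + q * x)| <= h * (L * x ^+ 2 + u)) ->
  fine (m [set x | d < `|x|]) <= C * r ->
  \int[m]_x (x ^+ 2 * \1_[set x | `|x| <= d] x) <= C * r ->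
  `|\int[m]_x (x * \1_[set x | `|x| <= d] x)| <= C * r ->
  `|\int[m]_x phi x - h * g| <= h * (u + (g + `|q| + L + C) * (C * r)).
Proof.
move=> mphi /andP[d0 d1] h0 L0 u0 g0 C0 r0 phiC phid mgt m2 m1.
have md := measurable_norm_le d; have md' := @measurable_norm_gt R d.
set S := [set x | `|x| <= d] in m1 m2 md *; set S' := [set x | d < _] in mgt md' *.
have SE x : \1_S x = 1 - \1_S' x :> R.
  rewrite !indicE; have [xd|xd] := leP `|x| d.
    by rewrite mem_set// memNset ?subr0// /S' /= ltNge xd.
  by rewrite memNset ?mem_set ?subrr// /S /= leNgt xd.
have bS (f : R -> R) : measurable_fun setT f -> (forall x, `|x| <= d -> `|f x| <= 1) ->
    m.-integrable setT (EFin \o (fun x => f x * \1_S x)).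
  move=> mf fb; apply: (@bounded_integrable _ _ _ _ _ 1).
    by apply: measurable_funM => //; exact: measurable_indic.
  move=> x; rewrite indicE; case: (boolP (x \in S)) => [/set_mem xS|_].
    by rewrite mulr1 fb.
  by rewrite mulr0 normr0.
have iX : m.-integrable setT (EFin \o (fun x => x * \1_S x)).
  by apply: (bS id) => // x xe; rewrite (le_trans xe).
have iX2 : m.-integrable setT (EFin \o (fun x => x ^+ 2 * \1_S x)).
  apply: (bS (fun x => x ^+ 2)); first exact: measurable_funX.
  by move=> x xe; rewrite normrX expr_le1// (le_trans xe).
have i1 : m.-integrable setT (EFin \o \1_S') by exact: integrable_indicR.
have ic (c : R) : m.-integrable setT (EFin \o (fun=> c)).
  by apply: (@bounded_integrable _ _ _ _ _ `|c|).
have iphi : m.-integrable setT (EFin \o phi).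
  apply: (@bounded_integrable _ _ _ _ _ (C * h)) => // x.
  by have /andP[p0 p1] := phiC x; rewrite ger0_norm.
pose lin x := h * q * (x * \1_S x).
have ilin : m.-integrable setT (EFin \o lin) by exact: integrable_scaleR.
pose B x := h * L * (x ^+ 2 * \1_S x) + (h * u + h * (g + C) * \1_S' x).
have iB : m.-integrable setT (EFin \o B).
  apply: integrable_addR; first exact: integrable_scaleR.
  by apply: integrable_addR => //; exact: integrable_scaleR.
have key x : `|phi x - h * g - lin x| <= B x.
  rewrite /lin /B SE indicE; case: (boolP (x \in S')) => [/set_mem xS|/negP xS].
    have /andP[p0 p1] := phiC x; rewrite subrr !mulr0 subr0 add0r mulr1.
    have hu : 0 <= h * u by rewrite mulr_ge0.
    have hg : 0 <= h * g by rewrite mulr_ge0.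
    by rewrite ler_norml; apply/andP; split; lra.
  have xd : `|x| <= d by rewrite leNgt; apply/negP => xd; apply: xS; rewrite inE.
  rewrite subr0 !mulr1 mulr0 addr0 (_ : _ - _ = phi x - h * (g + q * x)); last by ring.
  by rewrite (le_trans (phid x xd))// mulrDr mulrA.
have -> : \int[m]_x phi x - h * g =
    \int[m]_x (phi x - h * g - lin x) + h * q * \int[m]_x (x * \1_S x).
  transitivity (\int[m]_x (phi x - h * g)).
    by rewrite RintegralB// Rintegral_cst_probability.
  rewrite -RintegralZl// -RintegralD//; last exact: integrable_subR (integrable_subR iphi (ic _)) ilin.
  by congr fine; apply: eq_integral => x _; rewrite /lin subrK.
have idiff := integrable_subR (integrable_subR iphi (ic (h * g))) ilin.
rewrite (le_trans (ler_normD _ _))//.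
have H1 : `|\int[m]_x (phi x - h * g - lin x)| <= h * L * (C * r) + (h * u + h * (g + C) * (C * r)).
  rewrite (le_trans (le_normr_Rintegral _ idiff))//.
  apply: (@le_trans _ _ (\int[m]_x B x)).
    by apply: le_Rintegral => //; exact: integrable_norm.
  rewrite RintegralD//; [|exact: integrable_scaleR|by apply: integrable_addR => //; exact: integrable_scaleR].
  rewrite RintegralD//; last exact: integrable_scaleR.
  rewrite !RintegralZl// Rintegral_cst_probability Rintegral_indic//.
  by rewrite lerD// ?lerD2l ler_wpM2l ?mulr_ge0 ?addr_ge0.
have H2 : `|h * q * \int[m]_x (x * \1_S x)| <= h * `|q| * (C * r).
  by rewrite !normrM (ger0_norm h0) ler_wpM2l ?mulr_ge0.
lra.
Qed.

End one_step.

Section tail_expansion.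
Context {R : realType}.
Variables (sigma2 drift : R) (nu : {measure set R -> \bar R}).
Hypothesis sigma2_ge0 : 0 <= sigma2.
Hypothesis nuw : (\int[nu]_x (levy_weight x)%:E < +oo)%E.
Variable mu : R -> probability R R.
Hypothesis muE : has_exponent sigma2 drift nu mu.
Hypothesis muC : convolution_semigroup mu.
Let G (z : R) := fine (nu `[z, +oo[%classic).

(** [h] is the length of one step and [r] that of all the others, so at least two steps are taken.
    The terms of the constant come, in order, from: no big step; the relative error [t] allowed in
    one step; the expansion of [G] averaged at time [r]; two big steps or more. *)
Lemma tail_step (a eps d C t : R) n (y : R) (q L : R) :
  0 < a -> 0 < eps -> eps <= 1 -> eps <= a / 4 -> 0 < d -> d <= 1 -> d <= a / 4 -> 0 < C -> 0 <= L ->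
  0 < t < 1 -> a <= y ->
  let h := t / n.+2%:R in let r := n.+1%:R * h in
  fine (mu h [set x | eps < `|x|]) <= C * h ->
  \int[mu h]_x (x ^+ 2 * \1_[set x | `|x| <= eps] x) <= C * h ->
  `|\int[mu h]_x (x * \1_[set x | `|x| <= eps] x)| <= C * h ->
  fine (mu r [set x | d < `|x|]) <= C * r ->
  \int[mu r]_x (x ^+ 2 * \1_[set x | `|x| <= d] x) <= C * r ->
  `|\int[mu r]_x (x * \1_[set x | `|x| <= d] x)| <= C * r ->
  (forall x, `|x| <= d -> `|fine (mu h `[y - x, +oo[%classic) - h * G (y - x)| <= h * t) ->
  (forall x, `|x| <= d -> `|G (y - x) - G y - q * x| <= L * x ^+ 2) ->
  `|fine (mu t `[y, +oo[%classic) - t * G y| <=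
    (expR (C * (eps^-1 + 4 * eps ^- 2)) + 1 + (G y + `|q| + L + C) * C + C ^+ 2) * t ^+ 2.
Proof.
move=> a0 eps0 eps1 epsa d0 d1 da C0 L0 /andP[t0 t1] ay h r.
have h0 : 0 < h by rewrite divr_gt0.
have r0 : 0 < r by rewrite mulr_gt0.
have nh : n.+2%:R * h = t by rewrite /h mulrC divfK// pnatr_eq0.
have rt : r <= t by rewrite -nh ler_wpM2r ?(ltW h0)// ler_nat.
clearbody h => hJ h2 h1 rJ r2 r1 hG GL.
have G0 z : 0 <= G z by rewrite fine_ge0.
pose J : set R := [set x | eps < `|x|].
have mJ : measurable J by exact: measurable_norm_gt.
have my (z : R) : measurable (`[z, +oo[%classic : set R) by [].
pose f (x : R) : \bar R := (\1_(`[y, +oo[%classic : set R) x)%:E.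
have nf : nnmeasurable f.
  by split=> [|x]; [apply/measurable_EFinP; exact: measurable_indic|rewrite lee_fin indicE].
have f1 z : (f z <= 1)%E by rewrite lee_fin indicE; case: (_ \in _).
pose T := average (mu h) (cst 1).
pose B := average (mu h) \1_J.
have nBf : nnmeasurable (B f) by apply: nnmeasurable_average => //; exact: nnweight_indic.
pose phi x := fine (mu h (J `&` `[y - x, +oo[%classic)).
have BfE x : B f x = (phi x)%:E.
  rewrite /phi fineK ?fin_num_measure//; last exact: measurableI.
  rewrite -[X in mu h X]setIT -integral_indic//; last exact: measurableI.
  apply: eq_integral => z _; rewrite /f -EFinM; congr (_%:E).
  rewrite !indicE in_setI -mulnb natrM; congr (_ * (nat_of_bool _)%:R).
  by rewrite !mem_setE !in_itv/= !andbT lerBlDl.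
have phi_ge0 x : 0 <= phi x by rewrite fine_ge0.
have phiC x : 0 <= phi x <= C * h.
  rewrite phi_ge0 (le_trans _ hJ)// fine_le ?fin_num_measure//; first exact: measurableI.
  by rewrite le_measure ?inE//; exact: measurableI.
have phid x : `|x| <= d -> `|phi x - h * (G y + q * x)| <= h * (L * x ^+ 2 + t).
  move=> xd; have -> : phi x = fine (mu h `[y - x, +oo[%classic).
    congr (fine (mu h _)); apply/seteqP; split => [z []//|z /=].
    rewrite in_itv/= andbT => yz; split=> //.
    rewrite /J /= (lt_le_trans _ (ler_norm z))//.
    by have := ler_norm x; lra.
  rewrite (_ : _ - _ = (fine (mu h `[(y - x)%R, +oo[%classic) - h * G (y - x)) +
      h * (G (y - x) - G y - q * x)); last by ring.
  rewrite (le_trans (ler_normD _ _))// addrC [leRHS]mulrDr lerD ?hG//.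
  by rewrite normrM (gtr0_norm h0) ler_pM2l// GL.
have mphi : measurable_fun setT phi.
  have [mB _] := nBf; apply/measurable_EFinP.
  by rewrite (_ : _ \o _ = B f)//; apply/funext => x /=; rewrite BfE.
pose I := \int[mu r]_x phi x.
have HI : `|I - h * G y| <= h * (t + (G y + `|q| + L + C) * (C * r)).
  have d01 : 0 < d <= 1 by rewrite d0.
  exact: (integral_tail_expansion mphi d01 (ltW h0) L0 (ltW t0) (G0 y) (ltW C0) (ltW r0) phiC phid).
have IE : iter n.+1 T (B f) 0 = I%:E.
  rewrite iter_average_semigroup//; last exact: ltW.
  rewrite /I /Rintegral fineK; first by apply: eq_integral => x _; rewrite BfE.
  apply: integrable_fin_num => //; apply: (@bounded_integrable _ _ _ _ _ (C * h)) => // x.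
  by rewrite ger0_norm//; case/andP: (phiC x).
pose P := fine (mu t `[y, +oo[%classic).
have PE : iter n.+2 T f 0 = P%:E.
  rewrite iter_average_semigroup//; last exact: ltW.
  by rewrite nh integral_indic// setIT /P fineK// fin_num_measure.
(* [c * a = - 2 ln t] gives [expR (- c * y) <= t ^ 2] for [y >= a], and [eps <= a / 4] gives
   [t * expR (2 * c * eps) <= 1], so the exponential moment over all the steps stays below
   [expR kap]. *)
pose c := - (2 * ln t) / a.
have lnt : ln t < 0 by rewrite ln_lt0// t0.
have c0 : 0 < c by rewrite divr_gt0//; lra.
pose kap := C * (eps^-1 + 4 * eps ^- 2).
have kap0 : 0 <= kap.
  by rewrite mulr_ge0 ?(ltW C0)// addr_ge0 ?invr_ge0 ?(ltW eps0)// mulr_ge0 ?invr_ge0 ?exprn_ge0 ?(ltW eps0).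
have e01 : 0 < eps <= 1 by rewrite eps0.
have HA : (iter n.+2 (average (mu h) \1_(~` J)) f 0%R <= (expR kap * t ^+ 2)%:E)%E.
  have fe z : (f z <= (expR (- (c * y) + c * z))%:E)%E.
    rewrite lee_fin indicE; case: (boolP (z \in _)) => [|_]; last exact: expR_ge0.
    rewrite mem_setE in_itv/= andbT => yz; rewrite -expR0 ler_expR addrC -mulrBr.
    by rewrite mulr_ge0 ?subr_ge0// ltW.
  have := iter_average_expR mJ n.+2 0 nf fe (exponential_moment_small e01 (ltW c0) (ltW h0) (ltW C0) h2 h1).
  move=> /le_trans; apply; rewrite lee_fin mulr0 addr0 -expRM_natl.
  have ca : c * a = - (2 * ln t) by rewrite /c divfK// gt_eqF.
  apply: ler_pM; rewrite ?expR_ge0//.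
    rewrite ler_expR -/kap -[h * _ * _]mulrA mulrA nh mulrCA ler_piMr//.
    rewrite -ler_pdivlMl// mulr1 -[t^-1](@lnK _) ?posrE ?invr_gt0// lnV ?posrE// ler_expR.
    have : c * eps <= c * (a / 4) by rewrite ler_pM2l.
    lra.
  rewrite -[t in leRHS](@lnK _) ?posrE// -expRM_natl ler_expR.
  have : c * a <= c * y by rewrite ler_pM2l.
  lra.
have U := first_jump_le (mu h) mJ n.+2 0 nf.
have hJ' : (mu h J <= (C * h)%:E)%E by rewrite -[leLHS]fineK ?fin_num_measure// lee_fin.
have Ch0 : 0 <= C * h by rewrite mulr_ge0// ltW.
have LL := le_first_jump mJ n.+2 0 nf f1 hJ' Ch0.
have {}LL : n.+2%:R * I <= P + (n.+2%:R * (C * h)) ^+ 2.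
  by rewrite -lee_fin EFinD EFinM -IE -PE; exact: LL.
have {}U : P <= expR kap * t ^+ 2 + n.+2%:R * I.
  rewrite -lee_fin EFinD [X in (_ + X)%E]EFinM -IE -PE (le_trans U)//.
  by rewrite leeD2r.
have nCh : n.+2%:R * (C * h) = C * t by rewrite -nh; ring.
rewrite nCh exprMn in LL.
have HnI : `|n.+2%:R * I - t * G y| <= t * (t + (G y + `|q| + L + C) * (C * r)).
  rewrite -[t in X in `|X|]nh -mulrA -mulrBr normrM ger0_norm//.
  by rewrite -[t in leRHS]nh -mulrA ler_wpM2l// nh.
set K := G y + _ + _ + _ in HnI *.
have K0 : 0 <= K by rewrite !addr_ge0// ltW.
have Krt : t * (t + K * (C * r)) <= t * (t + K * (C * t)).
  by rewrite ler_pM2l// lerD2l ler_wpM2l// ler_pM2l.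
have e0 : 0 <= expR kap * t ^+ 2 by rewrite mulr_ge0 ?expR_ge0 ?sqr_ge0.
have C20 : 0 <= C ^+ 2 * t ^+ 2 by rewrite mulr_ge0 ?sqr_ge0.
move: HnI; rewrite !ler_norml -/P -/kap => /andP[HnI1 HnI2].
by apply/andP; split; lra.
Qed.

Lemma fin_num_nu_tail y : 0 < y -> nu `[y, +oo[%classic \is a fin_num.
Proof.
move=> y0; have : nu.-integrable setT (EFin \o (\1_(`[y, +oo[%classic : set R))).
  apply: (integrable_indic_away nuw y0) => // x /=.
  by rewrite in_itv/= andbT => /le_trans; apply; exact: ler_norm.
by move=> /(integrable_fin_num measurableT); rewrite integral_indic// setIT.
Qed.

(** The order of choice is what matters: [eps], [d] and [C], then [t], and only then the number of
    steps. The constant of [tail_step] is free of [n], so [n] can be as large as the precision [t]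
    requires. *)
Theorem tail_expansion (a b eta M : R) (q : R -> R) :
  0 < a -> 0 < eta -> eta < a -> 0 <= M ->
  (forall z1 z2, a - eta <= z1 -> z1 <= z2 -> z2 <= b + eta -> G z1 <= G z2 + M * (z2 - z1)) ->
  (forall y, a <= y <= b -> `|q y| <= M) ->
  (forall y x, a <= y <= b -> `|x| <= eta -> `|G (y - x) - G y - q y * x| <= M * x ^+ 2) ->
  exists k t0 : R, [/\ 0 < k, 0 < t0 & forall t y, 0 < t < t0 -> a <= y <= b ->
    `|fine (mu t `[y, +oo[%classic) - t * G y| <= k * t ^+ 2].
Proof.
move=> a0 eta0 etaa M0 GM qM GL.
pose eps := Num.min 1 (a / 4); pose d := Num.min eps (eta / 2).
have a4 : 0 < a / 4 by rewrite divr_gt0.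
have eps0 : 0 < eps by rewrite lt_min ltr01.
have eps1 : eps <= 1 by rewrite ge_min lexx.
have epsa : eps <= a / 4 by rewrite ge_min lexx orbT.
have d0 : 0 < d by rewrite lt_min eps0 divr_gt0.
have deps : d <= eps by rewrite ge_min lexx.
have deta : d <= eta / 2 by rewrite ge_min lexx orbT.
have e01 : 0 < eps <= 1 by rewrite eps0.
have d01 : 0 < d <= 1 by rewrite d0 (le_trans deps).
have [C C0 /near_at_right0P[t1 t10 HC]] := small_time_bounds sigma2_ge0 nuw muE e01 d01.
have G0 z : 0 <= G z by rewrite fine_ge0.
(* [G] is nonincreasing, so [G a] takes the place of [G y]; [M] takes that of [|q y|] and of the
   quadratic constant [L]. *)
exists (expR (C * (eps^-1 + 4 * eps ^- 2)) + 1 + (G a + M + M + C) * C + C ^+ 2), (Num.min 1 t1).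
split.
- have K0 : 0 <= (G a + M + M + C) * C by rewrite mulr_ge0 ?(ltW C0)// !addr_ge0// ltW.
  have := expR_gt0 (C * (eps^-1 + 4 * eps ^- 2)); have := sqr_ge0 C; lra.
- by rewrite lt_min ltr01.
move=> t y /andP[t0]; rewrite lt_min => /andP[tlt1 tt1] /[dup] yab /andP[ay yb].
have lo0 : 0 < a - d - d by lra.
have GMd z1 z2 : a - d - d <= z1 -> z1 <= z2 -> z2 <= b + d + d -> G z1 <= G z2 + M * (z2 - z1).
  by move=> ? ? ?; apply: GM => //; lra.
(* The precision is [t], so the threshold [h0] depends on [t]; the next line takes [n] with
   [t / (n + 2) < h0]. The point [y - x] moves by [d] and [tail_uniform] loses another [d], hence
   [a - d - d]. *)
have /near_at_right0P[h0 h00 Hh] := tail_uniform sigma2_ge0 nuw muE lo0 M0 d0 t0 GMd.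
pose n := Num.truncn (t / h0).
have nn : t / h0 < n.+1%:R by rewrite truncnS_gt.
have n20 : 0 < n.+2%:R :> R by rewrite ltr0n.
have th0 : 0 < t / n.+2%:R < h0.
  rewrite divr_gt0//= ltr_pdivrMr// mulrC -ltr_pdivrMr// (lt_trans nn)// ltr_nat//.
have /andP[hgt0 hh0] := th0.
have hn : n.+2%:R * (t / n.+2%:R) = t by rewrite mulrC divfK// gt_eqF.
have rt : n.+1%:R * (t / n.+2%:R) <= t by rewrite -[leRHS]hn ler_wpM2r ?(ltW hgt0)// ler_nat.
have ht : t / n.+2%:R <= t by rewrite -[leRHS]hn ler_peMl ?(ltW hgt0)// ler1n.
have r0 : 0 < n.+1%:R * (t / n.+2%:R) by rewrite mulr_gt0.
have [|[h1 h2 h3] _] := HC (t / n.+2%:R); first by rewrite hgt0 (le_lt_trans ht).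
have [|_ [r1 r2 r3]] := HC (n.+1%:R * (t / n.+2%:R)); first by rewrite r0 (le_lt_trans rt).
have dM : d <= a / 4 by exact: le_trans epsa.
have d1 : d <= 1 by exact: le_trans eps1.
have t01 : 0 < t < 1 by rewrite t0.
apply: (le_trans (tail_step (n := n) (q := q y) (L := M) a0 eps0 eps1 epsa d0 d1 dM C0 M0 t01 ay h1 h2 h3 r1 r2 r3 _ _)).
- move=> x xd; apply: Hh => //.
  by have := ler_norm x; have := ler_norm (- x); rewrite normrN => ? ?; apply/andP; split; lra.
- by move=> x xd; apply: GL => //; lra.
rewrite ler_wpM2r ?sqr_ge0// lerD2r lerD2l ler_wpM2r ?(ltW C0)// lerD2r lerD2r lerD ?qM//.
rewrite fine_le ?fin_num_nu_tail ?(lt_le_trans a0)// le_measure ?inE//.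
by apply: subitvPl; rewrite bnd_simp.
Qed.

End tail_expansion.

(** * Application to a Levy process and its reflection *)

Section law.
Context (d : measure_display) (T : measurableType d) (R : realType).
Variables (P : probability T R) (X : R -> {RV P >-> R}).

Definition scaled_law (sg t : R) : probability R R :=
  distribution P (scale_mfun sg (X t)).

Lemma integral_scaled_law sg t (f : R -> \bar R) : nnmeasurable f ->
  (\int[scaled_law sg t]_x f x = \int[P]_w f (X t w * sg)%R)%E.
Proof. by move=> [mf f0]; rewrite ge0_integral_distribution. Qed.

Hypothesis XL : levy_process X.

(** Independence of the increments over [[0, s]] and [[s, s + h]] makes their joint law a product,
    and stationarity identifies the second factor. The starting value is 0 only almost everywhere,
    hence the detour through [U]. *)
Lemma levy_increments_integral s h (f : R * R -> \bar R) : 0 <= s -> 0 <= h ->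
  measurable_fun setT f -> (forall z, (0 <= f z)%E) ->
  (\int[P]_w f (X s w, X (s + h) w - X s w)%R =
   \int[distribution P (X s)]_x \int[distribution P (X h)]_z f (x, z))%E.
Proof.
move=> s0 h0 mf f0; have [X0 XI XS _ _] := XL.
pose U w := X s w - X 0 w; pose V w := X (s + h) w - X s w.
have mU : measurable_fun setT U by exact: measurable_funB.
have mV : measurable_fun setT V by exact: measurable_funB.
have mX0 t (A : set R) : measurable A -> P [set w | A (X t w - X 0 w)] = distribution P (X t) A.
  move=> mA; have mI : measurable_fun setT (fun w => X t w - X 0 w) by exact: measurable_funB.
  have mA1 : measurable [set w | A (X t w - X 0 w)].
    by rewrite -[X in measurable X]setTI; exact: mI.
  have mA2 : measurable (X t @^-1` A) by rewrite -[X in measurable X]setTI; exact: measurable_funP.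
  have IE (S : set T) : measurable S -> P S = (\int[P]_w (\1_S w)%:E)%E.
    by move=> mS; rewrite integral_indic// setIT.
  rewrite (IE _ mA1) -[distribution P (X t) A]/(P (X t @^-1` A)) (IE _ mA2).
  apply: ge0_ae_eq_integral => //.
  - by apply/measurable_EFinP; exact: measurable_indic.
  - by apply/measurable_EFinP; exact: measurable_indic.
  apply: filterS X0 => w /= X0w _; rewrite !indicE; congr ((_ : bool)%:R%:E).
  by apply/idP/idP; rewrite !inE/= X0w subr0.
have mW : measurable_fun setT (fun w => (U w, V w)) by exact: measurable_fun_pair.
have prodE (A B : set R) : measurable A -> measurable B ->
    pushforward P (fun w => (U w, V w)) (A `*` B) = (distribution P (X s) A * distribution P (X h) B)%E.
  move=> mA mB; rewrite -!mX0// -(XS s h B)//.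
  pose tau (i : nat) : R := if i is 0%N then 0 else if i is 1%N then s else s + h.
  pose C (i : 'I_2) : set R := if val i is 0%N then A else B.
  have := XI 2%N tau C; rewrite big_ord_recl big_ord1 /= => <-//.
  - congr (P _); apply/seteqP; split=> w /=.
      by move=> [AU BV] [[|[|]]].
    by move=> CW; split; [exact: (CW ord0)|exact: (CW (lift ord0 ord0))].
  - by move=> [|[|]]//= _; rewrite lerDl.
  - by move=> [[|[|]]].
rewrite -(@fubini_tonelli1 _ _ _ _ _ (distribution P (X s)) (distribution P (X h)) f)//.
have -> : (\int[P]_w f (X s w, X (s + h)%R w - X s w)%R = \int[P]_w f (U w, V w))%E.
  apply: ge0_ae_eq_integral => //.
  - apply: measurableT_comp => //; apply: measurable_fun_pair => //.
  - by apply: measurableT_comp.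
  - by apply: filterS X0 => w /= X0w _; rewrite /U X0w subr0.
rewrite -(@ge0_integral_pushforward _ _ _ _ _ _ mW P setT f)//.
apply: eq_measure_integral => A mA _.
by apply/esym; exact: (product_measure_unique prodE).
Qed.

Lemma scaled_law_semigroup sg : convolution_semigroup (scaled_law sg).
Proof.
move=> s h s0 h0 f nf; have [mf f0] := nf.
have [mg g0] : nnmeasurable (fun x => f (x * sg)%R).
  by split => //; apply: measurableT_comp => //; exact: mulrr_measurable.
rewrite integral_scaled_law//.
rewrite (_ : (\int[P]_w _ = \int[P]_w (fun z : R * R => f ((z.1 + z.2) * sg)%R) (X s w, X (s + h)%R w - X s w)%R)%E); last first.
  by apply: eq_integral => w _ /=; rewrite subrKC.
rewrite (levy_increments_integral s0 h0 (f := fun z : R * R => f ((z.1 + z.2) * sg)%R))//; last first.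
  apply: (measurableT_comp mg).
  by apply: measurable_funD; [exact: measurable_fst|exact: measurable_snd].
pose g x := (\int[scaled_law sg h]_z f (x + z)%R)%E.
have ng : nnmeasurable g.
  have -> : g = average (scaled_law sg h) (cst 1) f.
    by apply/funext => x; apply: eq_integral => z _; rewrite mul1e.
  by apply: nnmeasurable_average => //; exact: nnweight1.
rewrite -/g integral_scaled_law//.
have -> : (\int[P]_w g (X s w * sg)%R = \int[distribution P (X s)]_x g (x * sg)%R)%E.
  rewrite ge0_integral_distribution//; last by move=> x; case: ng.
  by apply: measurableT_comp; [case: ng|exact: mulrr_measurable].
apply: eq_integral => x _; rewrite /g integral_scaled_law; last first.
  split=> // ; apply: measurableT_comp => //; exact: measurable_funD.
rewrite ge0_integral_distribution//.
  by apply: eq_integral => w _ /=; rewrite mulrDl.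
by rewrite /=; apply: (measurableT_comp mg); exact: measurable_funD.
Qed.

End law.

Section scaled_measure.
Context {R : realType}.
Variable nu : {measure set (measurableTypeR R) -> \bar R}.

Lemma measurable_scaleR (sg : R) :
  measurable_fun setT (fun x : measurableTypeR R => x * sg : R).
Proof. exact: mulrr_measurable. Qed.

Definition scaled_measure (sg : R) : {measure set R -> \bar R}.
Proof.
unshelve refine (pushforward nu (fun x : measurableTypeR R => x * sg : R) : {measure set R -> \bar R}).
exact: measurable_scaleR.
Defined.

Hypothesis nuL : levy_measure nu.
Variable sg : R.
Hypothesis sg1 : `|sg| = 1.

Lemma levy_weight_scale x : levy_weight (x * sg) = levy_weight x.
Proof. by rewrite /levy_weight exprMn -(real_normK (num_real sg)) sg1 expr1n mulr1. Qed.

Lemma scaled_measure_weight : (\int[scaled_measure sg]_x (levy_weight x)%:E < +oo)%E.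
Proof.
rewrite (ge0_integral_pushforward (measurable_scaleR sg))//=.
- case: nuL => _; under eq_integral => x _ do rewrite -[Num.min _ _]/(levy_weight x) -levy_weight_scale.
  exact.
- by apply/measurable_EFinP; exact: measurable_levy_weight.
- by move=> x _; rewrite lee_fin levy_weight_ge0.
Qed.

Lemma Rintegral_scaled_measure (f : R -> R) C : measurable_fun setT f ->
  (forall x, `|f x| <= C * levy_weight x) ->
  \int[scaled_measure sg]_x f x = \int[nu]_x f (x * sg).
Proof.
move=> mf fC; rewrite /Rintegral (integral_pushforward (measurable_scaleR sg))//.
  exact/measurable_EFinP.
have mw : measurable_fun setT (fun x : measurableTypeR R => (C * levy_weight x)%:E).
  by apply/measurable_EFinP; apply: measurable_funM => //; exact: measurable_levy_weight.
apply: (@le_integrable _ _ _ _ _ measurableT _ (fun x : measurableTypeR R => (C%:E * (levy_weight x)%:E)%E)).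
- apply: measurableT_comp; first exact/measurable_EFinP.
  exact: measurable_scaleR.
- move=> x _; rewrite -EFinM !abse_EFin lee_fin -levy_weight_scale.
  exact: le_trans (fC _) (ler_norm _).
- apply: integrableZl => //; apply/integrableP; split.
    by apply/measurable_EFinP; exact: measurable_levy_weight.
  by under eq_integral do rewrite /= ger0_norm ?levy_weight_ge0//; case: nuL.
Qed.

Lemma exponent_re_scaled sigma2 u :
  exponent_re sigma2 (scaled_measure sg) u = levy_exponent_re sigma2 nu (u * sg).
Proof.
rewrite /exponent_re /levy_exponent_re; congr (- (_ * _ / _) + _).
  by rewrite exprMn -(real_normK (num_real sg)) sg1 expr1n mulr1.
rewrite (@Rintegral_scaled_measure _ (u ^+ 2 + 2)); last exact: norm_cosB1_le.
  by congr fine; apply: eq_integral => x _; rewrite mulrA mulrAC.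
by apply: measurable_funB => //; exact: measurable_cosZ.
Qed.

(** The truncation [|x| <= 1] is invariant under reflection, so the drift changes by the factor [sg]
    and needs no correction. *)
Lemma exponent_im_scaled drift u :
  exponent_im (drift * sg) (scaled_measure sg) u = levy_exponent_im drift nu (u * sg).
Proof.
rewrite /exponent_im /levy_exponent_im; congr (_ + _); first by rewrite mulrAC mulrA.
rewrite (@Rintegral_scaled_measure _ (`|u| ^+ 3 + 1)); last exact: norm_sinB_small_part_le.
  congr fine; apply: eq_integral => x _; congr (_%:E).
  by rewrite /small_part normrM sg1 mulr1 [x * sg]mulrC !mulrA.
apply: measurable_funB; first exact: measurable_sinZ.
by apply: measurable_funM => //; exact: measurable_small_part.
Qed.

Lemma scaled_law_exponent d (T : measurableType d) (P : probability T R)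
    (X : R -> {RV P >-> R}) sigma2 drift :
  levy_triplet X sigma2 drift nu ->
  has_exponent sigma2 (drift * sg) (scaled_measure sg) (scaled_law X sg).
Proof.
move=> [s0 _ H] t u t0; have /= [Hc Hs] := H t (u * sg) t0.
rewrite exponent_re_scaled exponent_im_scaled.
have E (f : R -> R) : measurable_fun setT f -> (forall x, `|f x| <= 1) ->
    (\int[scaled_law X sg t]_x f (u * x))%:E = ('E_P[fun w => f (u * sg * X t w)%R])%E.
  move=> mf f1; rewrite unlock /Rintegral /scaled_law.
  have mg : measurable_fun setT (fun x : R => f (u * x)).
    by apply: measurableT_comp => //; exact: mulrl_measurable.
  have ig : P.-integrable setT (EFin \o (fun w => f (u * scale_mfun sg (X t) w))).
    apply: (@bounded_integrable _ _ _ _ _ 1) => //.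
    by apply: (measurableT_comp mg).
  rewrite integral_distribution//; last exact/measurable_EFinP.
  rewrite fineK; last exact: integrable_fin_num ig.
  by apply: eq_integral => w _ /=; congr ((f _)%:E); rewrite mulrAC mulrA.
split; apply: EFin_inj.
- rewrite -Hc E//; last exact: cos_max.
  by apply: continuous_measurable_fun; exact: continuous_cos.
- rewrite -Hs E//; last exact: sin_max.
  by apply: continuous_measurable_fun; exact: continuous_sin.
Qed.

End scaled_measure.

Lemma lipschitz_bound {R : realType} (f : R -> R) (A : set R) :
  [lipschitz f x | x in A] ->
  exists2 L, 0 <= L & forall x y, A x -> A y -> `|f x - f y| <= L * `|x - y|.
Proof.
move=> [M [Mreal HM]]; exists (`|M| + 1) => [|x y Ax Ay].
  by rewrite addr_ge0.
have /(_ (`|M| + 1)) := HM; rewrite (le_lt_trans (ler_norm M)) ?ltrDl// => /(_ isT).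
by move=> /(_ (x, y)); apply.
Qed.

Lemma open_segment_enlarge {R : realType} (D : set R) (a b : R) :
  open D -> a <= b -> `[a, b] `<=` D ->
  exists2 r, 0 < r & forall x, a - r <= x <= b + r -> D x.
Proof.
move=> oD ab abD.
have Da : D a by apply: abD; rewrite /= in_itv/= lexx.
have Db : D b by apply: abD; rewrite /= in_itv/= lexx ab.
have /nbhs_ballP[r1 /= r10 H1] := open_nbhs_nbhs (conj oD Da).
have /nbhs_ballP[r2 /= r20 H2] := open_nbhs_nbhs (conj oD Db).
have rm : 0 < Num.min r1 r2 by rewrite lt_min r10.
have m1 : Num.min r1 r2 <= r1 by rewrite ge_min lexx.
have m2 : Num.min r1 r2 <= r2 by rewrite ge_min lexx orbT.
exists (Num.min r1 r2 / 2); first by rewrite divr_gt0.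
move=> x /andP[xa xb]; have [xlta|ax] := ltP x a.
  apply: H1; rewrite /ball /= ltr_norml; apply/andP; split; lra.
have [xgtb|bx] := ltP b x.
  apply: H2; rewrite /ball /= ltr_norml; apply/andP; split; lra.
by apply: abD; rewrite /= in_itv/= ax.
Qed.

Section density.
Context {R : realType}.
Variables (nu : {measure set (measurableTypeR R) -> \bar R}) (s : R -> R).
Hypothesis nus : levy_density nu s.
Variable sg : R.
Hypothesis sg1 : sg = 1 \/ sg = -1.

Lemma lebesgue_scaled_itv (z1 z2 : R) : z1 <= z2 ->
  lebesgue_measure [set x : measurableTypeR R | z1 <= x * sg < z2] = (z2 - z1)%:E.
Proof.
move=> z12; case: sg1 => ->.
- rewrite (_ : [set _ | _] = `[z1, z2[%classic); last first.
    by apply/seteqP; split=> x /=; rewrite in_itv/= mulr1.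
  rewrite lebesgue_measure_itv/= lte_fin.
  by move: z12; rewrite le_eqVlt => /predU1P[->|->]; rewrite ?ltxx ?subrr// EFinB.
- rewrite (_ : [set _ | _] = `](- z2), (- z1)]%classic); last first.
    by apply/seteqP; split=> x /=; rewrite in_itv/= mulrN1 => /andP[? ?]; apply/andP; split; lra.
  rewrite lebesgue_measure_itv/= lte_fin ltrN2.
  move: z12; rewrite le_eqVlt => /predU1P[->|->]; rewrite ?ltxx ?subrr//.
  by rewrite -EFinB opprK addrC.
Qed.

Lemma scaled_measure_itv_bounds (z1 z2 c1 c2 : R) : 0 < z1 -> z1 <= z2 ->
  (forall z, z1 <= z < z2 -> c1 <= s (z * sg) <= c2) ->
  (((c1 * (z2 - z1))%:E <= scaled_measure nu sg `[z1, z2[%classic) /\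
   (scaled_measure nu sg `[z1, z2[%classic <= (c2 * (z2 - z1))%:E))%E.
Proof.
move=> z10 z12 sc; have [s0 ms nuE] := nus.
have sgsg : sg * sg = 1 by case: sg1 => ->; rewrite ?mulr1// mulrNN mulr1.
pose A := [set x : measurableTypeR R | z1 <= x * sg < z2].
have AE : (fun x : measurableTypeR R => x * sg : R) @^-1` `[z1, z2[%classic = A.
  by apply/seteqP; split=> x /=; rewrite in_itv.
have mA : measurable A.
  by rewrite -AE -[X in measurable X]setTI; apply: measurable_scaleR.
have A0 : A `<=` [set~ 0].
  by move=> x /= /andP[+ _] x0; rewrite x0 mul0r leNgt z10.
have scA x : A x -> c1 <= s x <= c2.
  by move=> Ax; have := sc _ Ax; rewrite -mulrA sgsg mulr1.
have -> : scaled_measure nu sg `[z1, z2[%classic = (\int[lebesgue_measure]_(x in A) (s x)%:E)%E.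
  by rewrite -nuE// -AE.
have sA0 x : A x -> 0 <= s x by move=> /A0 /eqP x0; exact: s0.
have mAs : measurable_fun A (fun x => (s x)%:E).
  by apply/measurable_EFinP; apply: measurable_funS ms => //; exact: measurableC.
split.
(* A negative [c1], as in the Lipschitz bound where [c1 = - M], is covered by the nonnegativity of
   [s]; otherwise nonnegative integrands are compared. *)
- have [c10|/ltW c10] := leP 0 c1; last first.
    rewrite (@le_trans _ _ 0%E)//; last by apply: integral_ge0 => x Ax; rewrite lee_fin sA0.
    by rewrite lee_fin mulr_le0_ge0 ?subr_ge0.
  rewrite EFinM -(lebesgue_scaled_itv z12) -integral_cst//.
  apply: ge0_le_integral => //.
  by move=> x /scA /andP[? _]; rewrite lee_fin.
- rewrite EFinM -(lebesgue_scaled_itv z12) -integral_cst//.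
  apply: ge0_le_integral => //; last by move=> x /scA /andP[_ ?]; rewrite lee_fin.
Qed.

Hypothesis nuL : levy_measure nu.

Let normsg : `|sg| = 1.
Proof. by case: sg1 => ->; rewrite ?normrN normr1. Qed.

Let G (z : R) := fine (scaled_measure nu sg `[z, +oo[%classic).

(** Serves twice: with the bounds [- M] and [M] for the Lipschitz property of the tail, and with
    [s (y * sg) - L * |x|] and [s (y * sg) + L * |x|] for its expansion at [y]. *)
Lemma scaled_tail_diff (z1 z2 c1 c2 : R) : 0 < z1 -> z1 <= z2 ->
  (forall z, z1 <= z < z2 -> c1 <= s (z * sg) <= c2) ->
  c1 * (z2 - z1) <= G z1 - G z2 <= c2 * (z2 - z1).
Proof.
move=> z10 z12 sc; have [h1 h2] := scaled_measure_itv_bounds z10 z12 sc.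
have fin z : 0 < z -> scaled_measure nu sg `[z, +oo[%classic \is a fin_num.
  by apply: fin_num_nu_tail; exact: scaled_measure_weight.
have finI : scaled_measure nu sg `[z1, z2[%classic \is a fin_num.
  by rewrite ge0_fin_numE// (le_lt_trans h2)// ltry.
have -> : G z1 - G z2 = fine (scaled_measure nu sg `[z1, z2[%classic).
  rewrite /G (_ : `[z1, +oo[%classic = `[z1, z2[%classic `|` `[z2, +oo[%classic); last first.
    by rewrite -itv_bndbnd_setU// bnd_simp.
  rewrite measureU// ?fineD ?fin ?(lt_le_trans z10)// ?addrK//.
  by apply/seteqP; split=> // x /= []; rewrite !in_itv/= andbT => /andP[_ h]; rewrite leNgt h.
by rewrite -!lee_fin fineK// h1.
Qed.

End density.

Section one_sided.
Context (d : measure_display) (T : measurableType d) (R : realType).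
Variables (P : probability T R) (X : R -> {RV P >-> R}).
Variables (sigma2 drift : R) (nu : {measure set (measurableTypeR R) -> \bar R}).
Variables (s : R -> R) (D0 : set R).
Hypothesis XL : levy_process X.
Hypothesis XT : levy_triplet X sigma2 drift nu.
Hypothesis nus : levy_density nu s.
Hypothesis sL : [lipschitz s x | x in D0 `\ 0].

(** [sg = 1] gives upper tails and [sg = -1] lower ones. The scaled measure has density
    [s (z * sg)], minus the derivative of its tail, and this is the slope [q]. *)
Lemma one_sided_expansion (sg a b r : R) : sg = 1 \/ sg = -1 ->
  0 < a -> a <= b -> 0 < r -> (forall z, a - r <= z <= b + r -> D0 (z * sg)) ->
  exists k t0 : R, [/\ 0 < k, 0 < t0 & forall t y, 0 < t < t0 -> a <= y <= b ->
    (`| t^-1%:E * P [set w | (y <= X t w * sg)%R] - nu [set x | (y <= x * sg)%R] |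
      <= (k * t)%:E)%E].
Proof.
move=> sg1 a0 ab r0 sgD.
have [sigma2_ge0 nuL _] := XT.
have normsg : `|sg| = 1 by case: sg1 => ->; rewrite ?normrN normr1.
have sg0 : sg != 0 by rewrite -normr_eq0 normsg oner_neq0.
have [L L0 sLip] := lipschitz_bound sL.
(* [eta <= r] keeps the enlarged segment inside [D0], and [eta <= a / 2] keeps it off 0. *)
pose eta := Num.min r (a / 2).
have eta0 : 0 < eta by rewrite lt_min r0 divr_gt0.
have etar : eta <= r by rewrite ge_min lexx.
have eta_a : eta < a.
  by rewrite (@le_lt_trans _ _ (a / 2)) ?ge_min ?lexx ?orbT//; lra.
have sD z1 z2 : a - eta <= z1 <= b + eta -> a - eta <= z2 <= b + eta ->
    `|s (z1 * sg) - s (z2 * sg)| <= L * `|z1 - z2|.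
  have inD z : a - eta <= z <= b + eta -> (D0 `\ 0) (z * sg).
    move=> /andP[az zb]; split; first by apply: sgD; apply/andP; split; lra.
    move=> /= /eqP; rewrite mulf_eq0 (negbTE sg0) orbF => /eqP z0; lra.
  move=> /inD h1 /inD h2; apply: le_trans (sLip _ _ h1 h2) _.
  by rewrite -mulrBl normrM normsg mulr1.
(* One [M] for all roles: it bounds [s] on the enlarged segment, by the Lipschitz property from the
   point [a], and it bounds [L]. *)
pose M := `|s (a * sg)| + L * (b - a + eta) + L.
have LM : L <= M by rewrite lerDr addr_ge0// mulr_ge0//; lra.
have M0 : 0 <= M by exact: le_trans LM.
have sM z : a - eta <= z <= b + eta -> `|s (z * sg)| <= M.
  move=> /[dup] zI /andP[az zb].
  have aI : a - eta <= a <= b + eta by apply/andP; split; lra.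
  have za : L * `|z - a| <= L * (b - a + eta).
    by rewrite ler_wpM2l// ler_norml; apply/andP; split; lra.
  have := sD z a zI aI.
  have := ler_normD (s (z * sg) - s (a * sg)) (s (a * sg)); rewrite subrK /M.
  lra.
have [|||k [t0 [k0 t00 H]]] := tail_expansion sigma2_ge0 (scaled_measure_weight nuL normsg)
  (scaled_law_exponent nuL normsg XT) (@scaled_law_semigroup _ _ _ _ _ XL sg)
  (b := b) (q := fun y => s (y * sg)) a0 eta0 eta_a M0.
- move=> z1 z2 az1 z12 z2b.
  have z10 : 0 < z1 by lra.
  have [|_] := andP (@scaled_tail_diff R nu s nus sg sg1 nuL z1 z2 (- M) M z10 z12 _).
    move=> z /andP[h1 h2]; rewrite -ler_norml sM//; apply/andP; split; lra.
  lra.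
- by move=> y /andP[ay yb]; apply: sM; apply/andP; split; lra.
- move=> y x /andP[ay yb]; rewrite ler_norml => /andP[x1 x2].
  have yI : a - eta <= y <= b + eta by apply/andP; split; lra.
  apply: (@le_trans _ _ (L * x ^+ 2)); last by rewrite ler_wpM2r ?sqr_ge0.
  (* Between [y] and [y - x] the density stays within [L * |x|] of its value at [y]; over a length
     [|x|] this costs [L * x ^ 2]. *)
  have slope z1 z2 : a - eta <= z1 -> z1 <= z2 -> z2 <= b + eta -> z1 <= y <= z2 ->
      forall z, z1 <= z < z2 ->
      s (y * sg) - L * (z2 - z1) <= s (z * sg) <= s (y * sg) + L * (z2 - z1).
    move=> h1 h2 h3 /andP[h4 h5] z /andP[h6 h7]; rewrite -ler_distl.
    apply: le_trans (sD _ _ _ yI) _; first by apply/andP; split; lra.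
    by rewrite ler_wpM2l// ler_norml; apply/andP; split; lra.
  have [x0|/ltW x0] := leP 0 x.
    have z10 : 0 < y - x by lra.
    have z12 : y - x <= y by lra.
    have := scaled_tail_diff nus sg1 nuL z10 z12 (slope _ _ _ z12 _ _).
    rewrite opprB addrCA subrr addr0 lexx z12 => /(_ _ _ isT) /andP[||]; try lra.
    by rewrite ler_norml expr2 => ? ?; apply/andP; split; lra.
  have y0 : 0 < y by lra.
  have z12 : y <= y - x by lra.
  have := scaled_tail_diff nus sg1 nuL y0 z12 (slope _ _ _ z12 _ _).
  rewrite addrAC subrr add0r lexx z12 => /(_ _ _ isT) /andP[||]; try lra.
  by rewrite ler_norml expr2 => ? ?; apply/andP; split; lra.
exists k, t0; split=> // t y t0t0 yI; have /andP[tpos _] := t0t0.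
have y0 : 0 < y by case/andP: yI; lra.
have -> : P [set w | y <= X t w * sg] = scaled_law X sg t `[y, +oo[%classic.
  by congr (P _); apply/seteqP; split=> w /=; rewrite in_itv/= andbT.
have -> : nu [set x | y <= x * sg] = scaled_measure nu sg `[y, +oo[%classic.
  by congr (nu _); apply/seteqP; split=> w /=; rewrite in_itv/= andbT.
rewrite -(fineK (fin_num_measure (scaled_law X sg t) _ _))//.
rewrite -(fineK (fin_num_nu_tail (scaled_measure_weight nuL normsg) y0)).
rewrite -EFinM -EFinB abse_EFin lee_fin.
have -> : forall u v : R, t^-1 * u - v = t^-1 * (u - t * v).
  by move=> u v; rewrite mulrBr mulrA mulVf ?mul1r// gt_eqF.
rewrite normrM gtr0_norm ?invr_gt0// ler_pdivrMl//.
by rewrite mulrCA -expr2; exact: H.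
Qed.

End one_sided.

Lemma ereal_sup_lt_rate {R : realType} (f : R -> R -> \bar R) (A : set R) (k t0 : R) :
  0 < k -> 0 < t0 -> (forall t y, 0 < t < t0 -> A y -> (f t y <= (k * t)%:E)%E) ->
  exists k t0 : R, [/\ 0 < k, 0 < t0 &
    forall t, 0 < t < t0 -> (ereal_sup [set f t y | y in A] < (k * t)%:E)%E].
Proof.
(* The supremum is at most [k * t]; the larger rate makes the inequality strict. *)
move=> k0 t00 H; exists (k + 1), t0; split=> //; first by rewrite addr_gt0.
move=> t /[dup] tt /andP[tpos _]; apply: (@le_lt_trans _ _ (k * t)%:E).
  by apply: ge_ereal_sup => _ [y Ay <-]; exact: H.
by rewrite lte_fin ltr_pM2r// ltrDl.
Qed.

Unset Implicit Arguments.

(** On the negative side the half-line [[y, +oo[] would contain a neighbourhood of 0, where [nu] may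
    be infinite; the tail that stays away from 0 is []-oo, y]]. *)
Theorem proposition2p1 (d : measure_display) (T : measurableType d)
    (R : realType) (P : probability T R) (X : R -> {RV P >-> R})
    (sigma2 drift : R) (nu : {measure set (measurableTypeR R) -> \bar R})
    (s : R -> R) (D0 : set R) (a b : R) :
  levy_process X ->
  levy_triplet X sigma2 drift nu ->
  levy_density nu s ->
  a <= b ->
  `[a, b] `<=` [set~ 0] ->
  open D0 ->
  `[a, b] `<=` D0 ->
  [lipschitz s x | x in D0 `\ 0] ->
  (forall delta : R, 0 < delta ->
    exists M : R, forall x : R, delta < `|x| -> s x <= M) ->
  (0 < a ->
    exists k t0 : R, [/\ 0 < k, 0 < t0 &
      forall t : R, 0 < t < t0 ->
        (ereal_sup [set `| t^-1%:E * P [set w | (y <= X t w)%R] - nu `[y, +oo[%classic|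
                   | y in `[a, b]] < (k * t)%:E)%E]) /\
  (b < 0 ->
    exists k t0 : R, [/\ 0 < k, 0 < t0 &
      forall t : R, 0 < t < t0 ->
        (ereal_sup [set `| t^-1%:E * P [set w | (X t w <= y)%R] - nu `]-oo, y]%classic|
                   | y in `[a, b]] < (k * t)%:E)%E]).
Proof.
move=> XL XT nus ab _ oD0 abD0 sL _.
have [r r0 rD0] := open_segment_enlarge oD0 ab abD0.
split=> [a0|b0].
- have [|k [t0 [k0 t00 H]]] :=
      one_sided_expansion XL XT nus sL (sg := 1) (or_introl erefl) a0 ab r0.
    by move=> z; rewrite mulr1; exact: rD0.
  apply: (ereal_sup_lt_rate k0 t00) => t y tt yab.
  rewrite (_ : [set w | _] = [set w | y <= X t w * 1]); last first.
    by apply/seteqP; split=> w /=; rewrite mulr1.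
  rewrite (_ : `[y, +oo[%classic = [set x | y <= x * 1]); last first.
    by apply/seteqP; split=> x /=; rewrite in_itv/= andbT mulr1.
  by apply: H => //; move: yab; rewrite /= in_itv.
- have Nb0 : 0 < - b by rewrite oppr_gt0.
  have Nba : - b <= - a by rewrite lerN2.
  have [|k [t0 [k0 t00 H]]] :=
      one_sided_expansion XL XT nus sL (sg := -1) (or_intror erefl) Nb0 Nba r0.
    by move=> z /andP[h1 h2]; apply: rD0; rewrite mulrN1; apply/andP; split; lra.
  apply: (ereal_sup_lt_rate k0 t00) => t y tt yab.
  rewrite (_ : [set w | _] = [set w | - y <= X t w * -1]); last first.
    by apply/seteqP; split=> w /=; rewrite mulrN1 lerN2.
  rewrite (_ : `]-oo, y]%classic = [set x | - y <= x * -1]); last first.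
    by apply/seteqP; split=> x /=; rewrite in_itv/= mulrN1 lerN2.
  by apply: H => //; move: yab; rewrite /= in_itv/= !lerN2 andbC.
Qed.
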